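(* Let $(X,\omega)$ be a compact Hermitian manifold of dimension $n$, let $\Sigma$ be a smooth analytic hypersurface of $X$, and let $t>0$ be a fixed real number. Let $(L,h)$ be a singular Hermitian holomorphic line bundle on $X$ whose metric $h$ has locally bounded weights. Then there exist a neighborhood $U_t$ of $\Sigma$ and a constant $a\in(0,1)$ such that the partial Bergman kernel function $P_{0,p}$ satisfies $$P_{0,p}(x)\leq a^p\quad\text{for all } x\in U_t \text{ and all } p\in\mathbb{N} \text{ with } p>2t^{-1}.$$ In particular $P_{0,p}=O(p^{-\infty})$ as $p\to\infty$ on $U_t$.
   Context: Singular metric: for a local holomorphic frame $e$ of $L$ on an open set $V$, the weight $\varphi$ of $h$ is the function on $V$ defined by $|e|_h=e^{-\varphi}$; ''$h$ has locally bounded weights'' means that all such $\varphi$ are locally bounded. No positivity of $(L,h)$ is assumed. For $p\in\mathbb{N}$ let $L^p=L^{\otimes p}$, $h_p=h^{\otimes p}$. On $H^0(X,L^p)$ (holomorphic sections) consider the inner product $(S,S')_p=\int_X\langle S,S'\rangle_{h_p}\,\frac{\omega^n}{n!}$ and norm $\|S\|_p^2=(S,S)_p$. Let $\lfloor x\rfloor$ be the integral part of $x$ and $$H^0_0(X,L^p):=H^0\big(X,L^p\otimes\mathcal{O}(-\lfloor tp\rfloor\Sigma)\big),$$ regarded as the space of sections in $H^0(X,L^p)$ vanishing to order at least $\lfloor tp\rfloor$ along $\Sigma$, with the inherited inner product. The partial Bergman kernel function is $P_{0,p}(x)=\sum_{j}|S_j^p(x)|_{h_p}^2$, $x\in X$,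 where $\{S_j^p\}$ is any orthonormal basis of $H^0_0(X,L^p)$; equivalently $P_{0,p}(x)=\max\{|S(x)|^2_{h_p}: S\in H^0_0(X,L^p),\ \|S\|_p=1\}$ (it is $0$ if the space is $\{0\}$). For functions $f_p$ on a manifold $M$, $f_p=O(p^{-\infty})$ means: for every compact $K\subset M$ and every $\ell\in\mathbb{N}$ there is $C_{K,\ell}>0$ with $\sup_K|f_p|\leq C_{K,\ell}\,p^{-\ell}$ for all $p\in\mathbb{N}$. *)

(* Defs.v *)
From HB Require Import structures.
From mathcomp Require Import all_boot all_order all_algebra complex.
From mathcomp Require Import all_classical all_reals all_analysis.

Set Implicit Arguments.
Unset Strict Implicit.
Unset Printing Implicit Defensive.

Import Order.TTheory GRing.Theory Num.Theory.
Import numFieldNormedType.Exports.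

Local Open Scope classical_set_scope.
Local Open Scope ring_scope.

(* R[i] seen as a numClosedFieldType: it is through this alias that the field
   of complex numbers receives the topology of its norm. *)
Definition Cplx (R : realType) : numClosedFieldType := R[i].

Section Euclidean.
Variable R : realType.
Local Notation C := (Cplx R).

Definition toC (x : R) : C := Complex x 0.
Definition reC (z : C) : R := complex.Re z.
Definition imC (z : C) : R := complex.Im z.
Definition modC (z : C) : R := reC `|z|.

Definition adjmx (m k : nat) (A : 'M[C]_(m, k)) : 'M[C]_(k, m) :=
  map_mx Num.conj A^T.

(* The identification of R^2n with C^n, (x, y) |-> x + i y. *)
Definition cvec (n : nat) (v : 'rV[R]_(n + n)) : 'rV[C]_n :=
  \row_j (Complex (lsubmx v ord0 j) (rsubmx v ord0 j) : C).

Fixpoint is_Ck (k m : nat) (D : set 'rV[R]_m) (f : 'rV[R]_m -> R) : Prop :=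
  (forall v, D v -> {for v, continuous f}) /\
  (if k is k'.+1 then
     forall j : 'I_m,
       (forall v, D v -> derivable f v (delta_mx ord0 j)) /\
       is_Ck k' D ('D_(delta_mx ord0 j) f)
   else True).

Definition smooth_on (m : nat) (D : set 'rV[R]_m) (f : 'rV[R]_m -> R) :=
  forall k, is_Ck k D f.

(* Integral over R^m with respect to the m-dimensional Lebesgue measure, as an
   iterated integral; it is only used for nonnegative Borel functions, for
   which the two agree by Tonelli's theorem. *)
Fixpoint lebesgue_int (m : nat) : ('rV[R]_m -> \bar R) -> \bar R :=
  if m is m'.+1 return ('rV[R]_m -> \bar R) -> \bar R then
    fun f => (\int[@lebesgue_measure R]_x
       lebesgue_int (fun v : 'rV[R]_m' =>
         f (row_mx (const_mx x : 'rV[R]_1) v)))%E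
  else fun f => f 0.

End Euclidean.

(* Complex manifolds. A chart i is a homeomorphism coord i, with inverse
   param i, from the open set cdom i onto an open subset of C^n; the values of
   coord i and param i outside these two sets are irrelevant. A function on an
   open subset of C^n is holomorphic when it is C-differentiable at each point
   of that set. *)
Record complex_atlas (R : realType) (n : nat) (X : ptopologicalType) := {
  chart : Type;
  cdom : chart -> set X;
  coord : chart -> X -> 'rV[Cplx R]_n;
  param : chart -> 'rV[Cplx R]_n -> X;
  cdom_open : forall i, open (cdom i);
  cdom_cover : forall x, exists i, cdom i x;
  coord_open : forall i, open (coord i @` cdom i);
  coordK : forall i x, cdom i x -> param i (coord i x) = x;
  coord_cont : forall i x, cdom i x -> {for x, continuous (coord i)};
  param_cont : forall i x, cdom i x ->
    {for coord i x, continuous (param i)};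
  transition_holo : forall i j x, cdom i x -> cdom j x ->
    differentiable (coord j \o param i) (coord i x)
}.

Notation borel X := (g_sigma_algebraType (@open X)).

Section Manifold.
Variables (R : realType) (n : nat) (X : ptopologicalType).
Variable M : complex_atlas R n X.
Local Notation C := (Cplx R).

(* Meant for open sets V: only the values of f near the points of V matter. *)
Definition holomorphic_on (V : set X) (f : X -> C) : Prop :=
  forall x, V x -> forall i : chart M, cdom i x ->
    differentiable (f \o param i) (coord i x).

(* The positive (1,1)-form omega of a Hermitian metric, written in the chart i
     omega = (i/2) sum_(j,k) g_jk dz_j /\ dzbar_k
   with g = gmat i smooth, Hermitian and positive definite. *)
Record hermitian_form := {
  gmat : chart M -> X -> 'M[C]_n;
  gmat_herm : forall i x, cdom i x -> adjmx (gmat i x) = gmat i x;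
  gmat_posdef : forall i x, cdom i x -> forall v : 'rV[C]_n, v != 0 ->
    0 < (v *m gmat i x *m adjmx v) ord0 ord0;
  gmat_smooth : forall i (j k : 'I_n),
    let D := @cvec R n @^-1` (coord i @` cdom i) in
    smooth_on D (fun v => reC (gmat i (param i (cvec v)) j k)) /\
    smooth_on D (fun v => imC (gmat i (param i (cvec v)) j k));
  gmat_change : forall i l x, cdom i x -> cdom l x ->
    let J := 'J (coord l \o param i) (coord i x) in
    gmat i x = J *m gmat l x *m adjmx J
}.

(* mu is the volume measure omega^n / n!. With the above normalization of the
   coefficients, omega^n / n! = det(g) dx_1 /\ dy_1 /\ ... /\ dx_n /\ dy_n. *)
Definition is_volume (omega : hermitian_form)
    (mu : {measure set (borel X) -> \bar R}) : Prop :=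
  forall (i : chart M) (A : set (borel X)), measurable A -> A `<=` cdom i ->
    mu A = lebesgue_int (fun v : 'rV[R]_(n + n) =>
      (reC (\det (gmat omega i (param i (cvec v))))
       * \1_(coord i @` A) (cvec v))%:E).

(* f generates the ideal of Sigma at each point of the open set V. *)
Definition defining_function (Sigma V : set X) (f : X -> C) : Prop :=
  [/\ open V, holomorphic_on V f, (forall x, V x -> (Sigma x <-> f x = 0)) &
      forall x, V x -> Sigma x -> forall i : chart M, cdom i x ->
        exists v : 'rV[C]_n, 'd (f \o param i) (coord i x) v != 0].

Definition smooth_hypersurface (Sigma : set X) : Prop :=
  closed Sigma /\
  forall x, Sigma x -> exists V f, V x /\ defining_function Sigma V f.

(* Holomorphic line bundle L given by an open cover, holomorphic frames e_a
   over tdom a, and transition functions: e_b = (trans a b) e_a. The transition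
   functions do not vanish since (trans a b) (trans b a) = 1. *)
Record line_bundle := {
  triv : Type;
  tdom : triv -> set X;
  trans : triv -> triv -> X -> C;
  tdom_open : forall a, open (tdom a);
  tdom_cover : forall x, exists a, tdom a x;
  trans_holo : forall a b, holomorphic_on (tdom a `&` tdom b) (trans a b);
  trans_id : forall a x, tdom a x -> trans a a x = 1;
  trans_cocycle : forall a b c x, tdom a x -> tdom b x -> tdom c x ->
    trans a b x * trans b c x = trans a c x
}.

Section LineBundle.
Variable L : line_bundle.

(* Some trivialization around x; the quantities defined below with it do not
   depend on the choice. *)
Definition triv_at (x : X) : triv L := projT1 (cid (tdom_cover L x)).

(* Holomorphic sections of L^p over the open set V, given by their
   coefficients: s = (s a) e_a^(p) over V `&` tdom a. *)
Definition is_section (p : nat) (V : set X) (s : triv L -> X -> C) : Prop :=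
  (forall a, holomorphic_on (V `&` tdom a) (s a)) /\
  (forall a b x, V x -> tdom a x -> tdom b x ->
     s a x = trans a b x ^+ p * s b x).

Definition is_frame (V : set X) (e : triv L -> X -> C) : Prop :=
  is_section 1 V e /\ forall a x, V x -> tdom a x -> e a x != 0.

(* s vanishes to order at least k along Sigma: it is locally divisible by the
   k-th power of a local equation of Sigma. *)
Definition vanishes_to_order (Sigma : set X) (k : nat)
    (s : triv L -> X -> C) : Prop :=
  forall x a V f, Sigma x -> tdom a x -> V x -> defining_function Sigma V f ->
    exists W g, [/\ open W, W x, W `<=` V `&` tdom a, holomorphic_on W g &
      forall y, W y -> s a y = f y ^+ k * g y].

Section Metric.
Variable mu : {measure set (borel X) -> \bar R}.

(* Singular Hermitian metric h on L, given by the norms hnorm a = |e_a|_h. The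
   values 0 and +oo of the norm, i.e. the values +oo and -oo of the weights,
   are left out, since weights that are locally bounded do not take them. The
   norm is measurable with respect to the completion of the Borel sets; for
   locally bounded weights this amounts to their being in L^1_loc. *)
Record singular_metric := {
  hnorm : triv L -> X -> R;
  hnorm_gt0 : forall a x, tdom a x -> 0 < hnorm a x;
  hnorm_change : forall a b x, tdom a x -> tdom b x ->
    hnorm b x = modC (trans a b x) * hnorm a x;
  hnorm_meas : forall a, exists f : borel X -> R,
    measurable_fun setT f /\ {ae mu, forall x, tdom a x -> hnorm a x = f x}
}.

Variable h : singular_metric.

Definition herm_prod (p : nat) (s s' : triv L -> X -> C) (x : X) : C :=
  let a := triv_at x in
  s a x * (s' a x)^* * toC (hnorm h a x ^+ (2 * p)%N).

Definition sqnorm (p : nat) (s : triv L -> X -> C) (x : X) : R :=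
  reC (herm_prod p s s x).

(* The weight phi of h in the frame e: |e|_h = exp (- phi). *)
Definition weight (e : triv L -> X -> C) (x : X) : R :=
  - ln (Num.sqrt (sqnorm 1 e x)).

Definition locally_bounded_weights : Prop :=
  forall V e, open V -> is_frame V e -> forall x, V x ->
    exists B : R, \forall y \near x, `|weight e y| <= B.

Definition inner_prod (p : nat) (s s' : triv L -> X -> C) : C :=
  Complex (\int[mu]_x reC (herm_prod p s s' x))
          (\int[mu]_x imC (herm_prod p s s' x)).

(* H^0_0(X, L^p); the truncation of t p is its integral part as 0 <= t p. *)
Definition in_H00 (Sigma : set X) (t : R) (p : nat)
    (s : triv L -> X -> C) : Prop :=
  is_section p setT s /\ vanishes_to_order Sigma (Num.truncn (t * p%:R)) s.

Definition orthonormal_basis (Sigma : set X) (t : R) (p d : nat)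
    (S : 'I_d -> triv L -> X -> C) : Prop :=
  [/\ forall j, in_H00 Sigma t p (S j),
      forall j k, inner_prod p (S j) (S k) = (j == k)%:R &
      forall s, in_H00 Sigma t p s -> exists c : 'I_d -> C,
        forall a x, tdom a x -> s a x = \sum_j c j * S j a x].

Definition is_partial_bergman (Sigma : set X) (t : R) (p : nat)
    (P : X -> R) : Prop :=
  exists d (S : 'I_d -> triv L -> X -> C),
    orthonormal_basis Sigma t p S /\
    forall x, P x = \sum_j sqnorm p (S j) x.

End Metric.
End LineBundle.
End Manifold.

(* f_p = O(p^(-oo)) on the open set U; here p ranges over the positive
   integers. *)
Definition O_p_minus_infty (R : realType) (X : topologicalType) (U : set X)
    (f : nat -> X -> R) : Prop :=
  forall K, compact K -> K `<=` U -> forall l : nat,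
    exists2 B : R, 0 < B &
      forall p x, (0 < p)%N -> K x -> `|f p x| <= B * (p%:R ^- l).

(* Main.v *)
(* For p > 2 / t the number k = floor(t p) is at least t p / 2. Near a point of
   Sigma, a section s of L^p vanishing to order k along Sigma is s = f^k w, with f
   a local equation of Sigma and w holomorphic. On the boundary of a square of
   fixed size centered at x, in a complex line transverse to Sigma, |f| >= c > 0,
   so that the maximum principle for w gives |s(x)| <= 2 (|f(x)| / c)^k sup |s|.
   All other estimates may lose a factor C^p, since |f|^(2 k) <= |f|^(t p) beats
   it close enough to Sigma. In particular sup |s|_h is compared with the L^2 norm
   of s crudely: around a point where |s|_h is almost maximal, Cauchy's estimate
   keeps |s| large on a ball of radius C^(-p), whose volume is at least C'^(-p).

   The maximum principle, with the constant 2, is proved for functions that are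
   only complex differentiable, from Goursat's theorem on rectangles. *)

Require Import Defs.
From HB Require Import structures.
From mathcomp Require Import all_boot all_order all_algebra complex.
From mathcomp Require Import all_classical all_reals all_analysis.
From mathcomp Require Import measurable_realfun.
From mathcomp Require Import ring lra.

Set Implicit Arguments.
Unset Strict Implicit.
Unset Printing Implicit Defensive.

Import Order.TTheory GRing.Theory Num.Theory.
Import numFieldNormedType.Exports.

Local Open Scope classical_set_scope.
Local Open Scope ring_scope.

(* The name coord is otherwise taken by the coordinates of vector.v. *)
Local Notation coord := Defs.coord.

(** * Goursat's theorem *)

Section RealGoursat.
Variable R : realType.
Implicit Types P Q A B : R -> R -> R.

(** Holomorphy is only complex differentiability at each point, so no derivative may be assumed
    continuous. Integrals along boundaries of rectangles are encoded by primitives in each real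
    variable separately, and all that is needed about them is extracted with the mean value theorem.
    The quotient s / f^k is given only locally at points of Sigma, each time by another function,
    and has to be glued before the maximum principle applies to it. The neighborhood may depend
    neither on p nor on the section. So the local constants are fixed before p and occur as
    [K ^+ p.+1] and [D ^+ p.+1], the extra factor absorbing what does not grow with p; the gain [e]
    is chosen after them. The metric is only bounded and measurable up to null sets: suprema need
    not be attained, lower bounds of integrals are proved without measurability, and additivity,
    needed to compute the norm of a combination of basis sections, is used on a conull Borel set. *)

Lemma primitive_ex (K : R) (f : R -> R) :
  (forall x, - K <= x <= K -> {for x, continuous f}) ->
  exists F : R -> R, forall x, - K < x < K -> is_derive x 1 F (f x).
Proof.
move=> cf; exists (fun x => \int[lebesgue_measure]_(u in `[- K, x]) f u)%R.
move=> x /andP[Kx xK].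
have fi : lebesgue_measure.-integrable `[- K, K] (EFin \o f).
  apply: continuous_compact_integrable; first exact: segment_compact.
  apply: continuous_in_subspaceT => u; rewrite inE /= in_itv /= => uK.
  exact: cf.
have [] := @continuous_FTC1_closed _ f (- K) x K xK fi Kx.
  by apply: cf; rewrite (ltW Kx) (ltW xK).
move=> dF F'; split; first exact: dF.
by rewrite -derive1E.
Qed.

(* Green's formula in disguise: if A and B are primitives of P in x and of Q in
   y, this is the integral of P dx + Q dy along the boundary of the rectangle,
   for D = B - A. *)
Definition mixed (D : R -> R -> R) (x0 x1 y0 y1 : R) : R :=
  D x1 y1 - D x1 y0 - D x0 y1 + D x0 y0.

(* Closedness is the coefficient b shared by dP and dQ. *)
Definition closed_form_at P Q (x y : R) := exists a b c : R,
  forall e : R, 0 < e -> exists2 d : R, 0 < d & forall x' y' : R,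
    `|x' - x| < d -> `|y' - y| < d ->
    `|P x' y' - P x y - (a * (x' - x) + b * (y' - y))|
      <= e * (`|x' - x| + `|y' - y|) /\
    `|Q x' y' - Q x y - (b * (x' - x) + c * (y' - y))|
      <= e * (`|x' - x| + `|y' - y|).

Section Primitives.
Variables (K : R) (P Q A B : R -> R -> R).
Hypothesis dA : forall x y, - K < x < K -> - K < y < K ->
  is_derive x 1 (A ^~ y) (P x y).
Hypothesis dB : forall x y, - K < x < K -> - K < y < K ->
  is_derive y 1 (B x) (Q x y).
Let D x y := B x y - A x y.

(** The mean value theorem is applied to the difference of the primitives on opposite sides, so a
    single [xi] serves both horizontal sides and a single [eta] both vertical ones. This replaces
    every evaluation of a boundary integral below: size estimates in [goursat] and
    [mixed_removable], signs in [center_le_boundary]. *)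
Lemma mixed_MVT x0 x1 y0 y1 : - K < x0 -> x0 < x1 -> x1 < K ->
  - K < y0 -> y0 < y1 -> y1 < K ->
  exists xi eta, [/\ x0 <= xi <= x1, y0 <= eta <= y1 &
    mixed D x0 x1 y0 y1 =
      (x1 - x0) * (P xi y0 - P xi y1) + (y1 - y0) * (Q x1 eta - Q x0 eta)].
Proof.
move=> Kx0 x01 x1K Ky0 y01 y1K.
have inK a b u : - K < a -> b < K -> u \in `[a, b] -> - K < u < K.
  rewrite in_itv /= => Ka bK /andP[au ub].
  by rewrite (lt_le_trans Ka au) (le_lt_trans ub bK).
have y0K : - K < y0 < K by rewrite Ky0 (lt_trans y01).
have y1K' : - K < y1 < K by rewrite y1K (lt_trans Ky0).
have x0K : - K < x0 < K by rewrite Kx0 (lt_trans x01).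
have x1K' : - K < x1 < K by rewrite x1K (lt_trans Kx0).
pose a u := A u y0 - A u y1; pose b v := B x1 v - B x0 v.
have da u : u \in `[x0, x1] -> is_derive u 1 a (P u y0 - P u y1).
  move=> /(inK _ _ _ Kx0 x1K) uK.
  by apply: is_deriveB; exact: dA.
have db v : v \in `[y0, y1] -> is_derive v 1 b (Q x1 v - Q x0 v).
  move=> /(inK _ _ _ Ky0 y1K) vK.
  by apply: is_deriveB; exact: dB.
have ca : {within `[x0, x1], continuous a}.
  by apply: derivable_within_continuous => u uI; case: (da u uI).
have cb : {within `[y0, y1], continuous b}.
  by apply: derivable_within_continuous => u uI; case: (db u uI).
have da' u : u \in `]x0, x1[ -> is_derive u 1 a (P u y0 - P u y1).
  by move=> uI; apply: da; exact: subset_itv_oo_cc.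
have db' u : u \in `]y0, y1[ -> is_derive u 1 b (Q x1 u - Q x0 u).
  by move=> uI; apply: db; exact: subset_itv_oo_cc.
have [xi xi_in Exi] := MVT x01 da' ca.
have [eta eta_in Eeta] := MVT y01 db' cb.
exists xi, eta; split.
- by move: xi_in; rewrite in_itv /= => /andP[/ltW-> /ltW->].
- by move: eta_in; rewrite in_itv /= => /andP[/ltW-> /ltW->].
rewrite (mulrC (x1 - x0)) (mulrC (y1 - y0)) -Exi -Eeta.
by rewrite /mixed /D /a /b; ring.
Qed.

Lemma mixed_split_x (E : R -> R -> R) x x0 x1 y0 y1 :
  mixed E x0 x1 y0 y1 = mixed E x0 x y0 y1 + mixed E x x1 y0 y1.
Proof. by rewrite /mixed; ring. Qed.

Lemma mixed_split_y (E : R -> R -> R) y x0 x1 y0 y1 :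
  mixed E x0 x1 y0 y1 = mixed E x0 x1 y0 y + mixed E x0 x1 y y1.
Proof. by rewrite /mixed; ring. Qed.

Lemma mixed_xx (E : R -> R -> R) x y0 y1 : mixed E x x y0 y1 = 0.
Proof. by rewrite /mixed; ring. Qed.

Lemma mixed_yy (E : R -> R -> R) x0 x1 y : mixed E x0 x1 y y = 0.
Proof. by rewrite /mixed; ring. Qed.

Lemma quarter_ex (E : R -> R -> R) x0 x1 y0 y1 : x0 < x1 -> y0 < y1 ->
  exists r : R * R * (R * R), let: (a, b, (c, d)) := r in
  [/\ x0 <= a < b, b <= x1, y0 <= c < d, d <= y1 &
   [/\ b - a = (x1 - x0) / 2, d - c = (y1 - y0) / 2 &
      `|mixed E x0 x1 y0 y1| <= 4 * `|mixed E a b c d|]].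
Proof.
move=> x01 y01.
set xm := (x0 + x1) / 2; set ym := (y0 + y1) / 2.
have Hx : x0 < xm < x1 by rewrite /xm; lra.
have Hy : y0 < ym < y1 by rewrite /ym; lra.
have /andP[xa xb] := Hx; have /andP[ya yb] := Hy.
set m := mixed E.
have [H1|H1] := leP `|m x0 x1 y0 y1| (4 * `|m x0 xm y0 ym|).
  exists (x0, xm, (y0, ym));
  by split; [lra..|split => //; rewrite /xm /ym; lra].
have [H2|H2] := leP `|m x0 x1 y0 y1| (4 * `|m x0 xm ym y1|).
  exists (x0, xm, (ym, y1));
  by split; [lra..|split => //; rewrite /xm /ym; lra].
have [H3|H3] := leP `|m x0 x1 y0 y1| (4 * `|m xm x1 y0 ym|).
  exists (xm, x1, (y0, ym));
  by split; [lra..|split => //; rewrite /xm /ym; lra].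
have [H4|H4] := leP `|m x0 x1 y0 y1| (4 * `|m xm x1 ym y1|).
  exists (xm, x1, (ym, y1));
  by split; [lra..|split => //; rewrite /xm /ym; lra].
exfalso.
have : `|m x0 x1 y0 y1| <=
    `|m x0 xm y0 ym| + `|m x0 xm ym y1| + (`|m xm x1 y0 ym| + `|m xm x1 ym y1|).
  rewrite /m (mixed_split_x E xm) (mixed_split_y E ym x0) (mixed_split_y E ym xm).
  apply: (le_trans (ler_normD _ _)); apply: lerD; exact: ler_normD.
lra.
Qed.

Lemma bisection_point (x0 x1 y0 y1 : nat -> R) :
  (forall n, x0 n <= x0 n.+1 /\ x1 n.+1 <= x1 n) ->
  (forall n, x0 n <= x1 n) -> exists u, forall n, x0 n <= u <= x1 n.
Proof.
move=> mono le01.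
have m0 m n : (m <= n)%N -> x0 m <= x0 n.
  by move/subnK <-; elim: (n - m)%N => // k /le_trans; apply; case: (mono (k + m)%N).
have m1 m n : (m <= n)%N -> x1 n <= x1 m.
  move/subnK <-; elim: (n - m)%N => // k; apply: le_trans.
  by case: (mono (k + m)%N).
have le2 m n : x0 m <= x1 n.
  apply: (le_trans (m0 _ (maxn m n) (leq_maxl _ _))).
  by apply: (le_trans (le01 _)); apply: m1; exact: leq_maxr.
exists (sup (range x0)) => n; apply/andP; split.
  apply: ub_le_sup; last by exists n.
  by exists (x1 0%N) => _ [k _ <-].
by apply: ge_sup; [exists (x0 0%N), 0%N|move=> _ [k _ <-]].
Qed.

(** Bisection: after n steps a quarter carries at least 4^(-n) of the total, while first-order
    approximation at the limit point bounds it by 2 e s^2, where s is 2^(-n) times the sum of the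
    original sides. The powers of 4 cancel. *)
Lemma goursat x0 x1 y0 y1 : - K < x0 -> x0 < x1 -> x1 < K ->
  - K < y0 -> y0 < y1 -> y1 < K ->
  (forall x y, x0 <= x <= x1 -> y0 <= y <= y1 -> closed_form_at P Q x y) ->
  mixed D x0 x1 y0 y1 = 0.
Proof.
move=> Kx0 x01 x1K Ky0 y01 y1K dPQ.
pose T := (R * R * (R * R))%type.
(* The choice function has to be total, so nondegeneracy is a premise of the specification;
   degenerate rectangles are sent to themselves. *)
have /choice [g gP] : forall r : T, exists r' : T,
    let: (a, b, (c, d)) := r in let: (a', b', (c', d')) := r' in
    a < b -> c < d -> [/\ a <= a' < b', b' <= b, c <= c' < d', d' <= d &
   [/\ b' - a' = (b - a) / 2, d' - c' = (d - c) / 2 &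
      `|mixed D a b c d| <= 4 * `|mixed D a' b' c' d'|]].
  move=> [[a b] [c d]]; have [ab|] := ltP a b; last first.
    by move=> ba; exists (a, b, (c, d)) => ab; exfalso; lra.
  have [cd|] := ltP c d; last first.
    by move=> dc; exists (a, b, (c, d)) => _ cd; exfalso; lra.
  have [[[a' b'] [c' d']] H] := quarter_ex D ab cd.
  by exists (a', b', (c', d')).
pose r n := iter n g (x0, x1, (y0, y1)).
pose a n := (r n).1.1; pose b n := (r n).1.2.
pose c n := (r n).2.1; pose d n := (r n).2.2.
have step n : a n < b n -> c n < d n ->
   [/\ a n <= a n.+1 < b n.+1, b n.+1 <= b n, c n <= c n.+1 < d n.+1,
       d n.+1 <= d n &
   [/\ b n.+1 - a n.+1 = (b n - a n) / 2, d n.+1 - c n.+1 = (d n - c n) / 2 &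
      `|mixed D (a n) (b n) (c n) (d n)|
        <= 4 * `|mixed D (a n.+1) (b n.+1) (c n.+1) (d n.+1)|]].
  have := gP (r n); rewrite -[g (r n)]/(r n.+1) /a /b /c /d.
  case: (r n) => [[p q] [s k]]; case: (r n.+1) => [[p' q'] [s' k']].
  exact.
have abcd n : a n < b n /\ c n < d n.
  elim: n => [//|n [abn cdn]].
  by have [/andP[_ ->] _ /andP[_ ->] _ _] := step n abn cdn.
have {}step n := step n (abcd n).1 (abcd n).2.
have [u uP] : exists u, forall n, a n <= u <= b n.
  apply: (bisection_point (x0 := a) (x1 := b) (fun=> 0) (fun=> 0)).
    by move=> n; have [/andP[-> _] -> _ _ _] := step n.
  by move=> n; rewrite ltW //; case: (abcd n).
have [v vP] : exists v, forall n, c n <= v <= d n.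
  apply: (bisection_point (x0 := c) (x1 := d) (fun=> 0) (fun=> 0)).
    by move=> n; have [_ _ /andP[-> _] -> _] := step n.
  by move=> n; rewrite ltW //; case: (abcd n).
have inside n : [/\ - K < a n, b n < K, - K < c n & d n < K].
  elim: n => [//|n [h1 h2 h3 h4]].
  have [/andP[l1 _] l2 /andP[l3 _] l4 _] := step n.
  by rewrite (lt_le_trans h1 l1) (le_lt_trans l2 h2) (lt_le_trans h3 l3)
             (le_lt_trans l4 h4).
pose w := x1 - x0; pose h := y1 - y0.
have wE n : b n - a n = w / 2 ^+ n.
  elim: n => [|n IH]; first by rewrite expr0 divr1.
  by have [_ _ _ _ [-> _ _]] := step n; rewrite IH exprSr invfM mulrA.
have hE n : d n - c n = h / 2 ^+ n.
  elim: n => [|n IH]; first by rewrite expr0 divr1.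
  by have [_ _ _ _ [_ -> _]] := step n; rewrite IH exprSr invfM mulrA.
have mE n : `|mixed D x0 x1 y0 y1| <= 4 ^+ n * `|mixed D (a n) (b n) (c n) (d n)|.
  elim: n => [|n IH]; first by rewrite mul1r.
  apply: (le_trans IH); rewrite exprSr -mulrA ler_wpM2l ?exprn_ge0 //.
  by have [_ _ _ _ [_ _ ->]] := step n.
have [k1 [k2 [k3 kP]]] := dPQ u v (uP 0%N) (vP 0%N).
have small e : 0 < e -> `|mixed D x0 x1 y0 y1| <= 2 * e * (w + h) ^+ 2.
  move=> e0; have [dl dl0 near] := kP e e0.
  have wh0 : 0 < w + h by rewrite /w /h; lra.
  have [n nP] : exists n, (w + h) / 2 ^+ n < dl.
    have [n n_lt] : exists n : nat, (w + h) / dl < n%:R.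
      exists (Num.truncn ((w + h) / dl)).+1; exact: truncnS_gt.
    exists n; rewrite ltr_pdivrMr ?exprn_gt0 // mulrC -ltr_pdivrMr //.
    apply: (lt_le_trans n_lt); rewrite -natrX ler_nat.
    by apply: ltnW; exact: ltn_expl.
  apply: (le_trans (mE n)).
  have [a1 a2 a3 a4] := inside n.
  have [xi [eta [xiP etaP ->]]] :=
    mixed_MVT a1 (abcd n).1 a2 a3 (abcd n).2 a4.
  have sz (p q : R) : a n <= p <= b n -> c n <= q <= d n ->
      [/\ `|p - u| < dl, `|q - v| < dl &
          `|p - u| + `|q - v| <= (w + h) / 2 ^+ n].
    move=> /andP[p1 p2] /andP[q1 q2].
    have /andP[u1 u2] := uP n; have /andP[v1 v2] := vP n.
    have pu : `|p - u| <= w / 2 ^+ n by rewrite -wE ler_norml; lra.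
    have qv : `|q - v| <= h / 2 ^+ n by rewrite -hE ler_norml; lra.
    have hu := normr_ge0 (p - u); have hv := normr_ge0 (q - v).
    have le1 := le_lt_trans (lerD pu qv); rewrite -mulrDl in le1.
    have lt1 := le1 _ nP.
    split; [|by apply: le_lt_trans lt1; rewrite lerDr|].
      by apply: le_lt_trans lt1; rewrite lerDl.
    by rewrite mulrDl; exact: lerD.
  have /andP[ab' cd'] : (a n <= b n) && (c n <= d n).
    by have [/ltW-> /ltW->] := abcd n.
  have cc : c n <= c n <= d n by rewrite lexx.
  have dd : c n <= d n <= d n by rewrite lexx andbT.
  have aa : a n <= a n <= b n by rewrite lexx.
  have bb : a n <= b n <= b n by rewrite lexx andbT.
  have bnd (p q : R) : a n <= p <= b n -> c n <= q <= d n ->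
      `|P p q - P u v - (k1 * (p - u) + k2 * (q - v))| <= e * ((w + h) / 2 ^+ n) /\
      `|Q p q - Q u v - (k2 * (p - u) + k3 * (q - v))| <= e * ((w + h) / 2 ^+ n).
    move=> /sz sp /sp [s1 s2 s3]; have [n1 n2] := near p q s1 s2.
    by split; [apply: (le_trans n1)|apply: (le_trans n2)]; rewrite ler_pM2l.
  have [pc _] := bnd _ _ xiP cc; have [pd _] := bnd _ _ xiP dd.
  have [_ qa] := bnd _ _ aa etaP; have [_ qb] := bnd _ _ bb etaP.
  set s := (w + h) / 2 ^+ n in pc pd qa qb.
  have s0 : 0 <= s by apply: divr_ge0; [exact: ltW|rewrite exprn_ge0].
  set W := b n - a n; set H := d n - c n.
  have W0 : 0 <= W by rewrite subr_ge0.
  have H0 : 0 <= H by rewrite subr_ge0.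
  have WH : W + H = s by rewrite /W /H wE hE -mulrDl.
  set e1 := P xi (c n) - _ - _ in pc; set e2 := P xi (d n) - _ - _ in pd.
  set e3 := Q (a n) eta - _ - _ in qa; set e4 := Q (b n) eta - _ - _ in qb.
  (* Closedness enters here: the linear parts contribute [- k2 * W * H] on the horizontal sides and
     [k2 * W * H] on the vertical ones, and cancel. Only the errors remain. *)
  have -> : W * (P xi (c n) - P xi (d n)) + H * (Q (b n) eta - Q (a n) eta)
     = W * (e1 - e2) + H * (e4 - e3).
    by rewrite /e1 /e2 /e3 /e4 /W /H; ring.
  have s2 : 4 ^+ n * s ^+ 2 = (w + h) ^+ 2.
    have -> : (4 : R) = 2 ^+ 2 by rewrite -natrX.
    by rewrite /s expr_div_n -!exprM mulnC mulrC divfK // expf_neq0 // pnatr_eq0.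
  have -> : 2 * e * (w + h) ^+ 2 = 4 ^+ n * (2 * e * s ^+ 2).
    by rewrite -s2; ring.
  rewrite ler_pM2l ?exprn_gt0 //.
  apply: (le_trans (ler_normD _ _)); rewrite !normrM (ger0_norm W0) (ger0_norm H0).
  have n12 : `|e1 - e2| <= 2 * (e * s).
    by rewrite mulr_natl mulr2n (le_trans (ler_normB _ _)) ?lerD.
  have n43 : `|e4 - e3| <= 2 * (e * s).
    by rewrite mulr_natl mulr2n (le_trans (ler_normB _ _)) ?lerD.
  apply: (@le_trans _ _ (W * (2 * (e * s)) + H * (2 * (e * s)))).
    by rewrite lerD // ler_wpM2l.
  by rewrite -mulrDl WH expr2 le_eqVlt; apply/orP; left; apply/eqP; ring.
apply/eqP; rewrite -normr_eq0; apply/negP => /negP m0.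
have wh : 0 < w + h by rewrite /w /h; lra.
have wh0 : 0 < (w + h) ^+ 2 by rewrite exprn_gt0.
have m_gt0 : 0 < `|mixed D x0 x1 y0 y1| by rewrite lt_neqAle eq_sym m0 normr_ge0.
(* With this value of e the bound says that a positive number is at most its half. *)
have := small (`|mixed D x0 x1 y0 y1| / (4 * (w + h) ^+ 2)).
rewrite divr_gt0 ?mulr_gt0 // => /(_ isT).
rewrite leNgt => /negP; apply.
set m := `|_| in m_gt0 *; set z := (w + h) ^+ 2 in wh0 *.
have -> : 2 * (m / (4 * z)) * z = m / 2 by field; rewrite gt_eqF.
lra.
Qed.

End Primitives.
End RealGoursat.

(** * Exceptional points in Goursat's theorem *)

Section RemovablePoints.
Variables (R : realType) (K : R) (P Q A B : R -> R -> R).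
Hypothesis dA : forall x y, - K < x < K -> - K < y < K ->
  is_derive x 1 (A ^~ y) (P x y).
Hypothesis dB : forall x y, - K < x < K -> - K < y < K ->
  is_derive y 1 (B x) (Q x y).
Let D x y := B x y - A x y.

(** [N] is the set of points where differentiability is not known. It is kept as a predicate so that
    such points can be removed one at a time. *)
Definition rect_avoids (N : R -> R -> Prop) (x0 x1 y0 y1 : R) :=
  forall x y, x0 <= x <= x1 -> y0 <= y <= y1 -> ~ N x y.

Definition mixed_vanishes (N : R -> R -> Prop) :=
  forall x0 x1 y0 y1, - K < x0 -> x0 < x1 -> x1 < K ->
    - K < y0 -> y0 < y1 -> y1 < K -> rect_avoids N x0 x1 y0 y1 ->
    mixed D x0 x1 y0 y1 = 0.

(** The rectangle is cut into four pieces that miss the point and a rectangle with sides at most 2 e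
    around it, where boundedness of P and Q alone gives a contribution of at most 8 C e. *)
Lemma mixed_removable (N : R -> R -> Prop) (u v : R) :
  (exists2 d : R, 0 < d & exists C : R, forall x y, `|x - u| <= d ->
     `|y - v| <= d -> `|P x y| <= C /\ `|Q x y| <= C) ->
  mixed_vanishes (fun x y => N x y \/ x = u /\ y = v) -> mixed_vanishes N.
Proof.
move=> [d d0 [C bd]] van x0 x1 y0 y1 Kx0 x01 x1K Ky0 y01 y1K av.
have [uvin|/negP uvout] := boolP [&& x0 <= u, u <= x1, y0 <= v & v <= y1];
    last first.
  apply: van => // x y xI yI; case; first exact: av.
  move=> [xu yv]; apply: uvout; move: xI yI; rewrite xu yv.
  by move=> /andP[-> ->] /andP[-> ->].
have /and4P[x0u ux1 y0v vy1] := uvin.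
have C0 : 0 <= C.
  have [] := bd u v; rewrite ?subrr ?normr0 ?(ltW d0) // => h _.
  exact: le_trans h.
have zero p q s t : x0 <= p -> p <= q -> q <= x1 -> y0 <= s -> s <= t ->
    t <= y1 -> [\/ p = q \/ s = t, q < u \/ u < p | t < v \/ v < s] ->
    mixed D p q s t = 0.
  move=> p1 pq q1 s1 st t1 far.
  have [->|pq'] := eqVneq p q; first exact: mixed_xx.
  have [->|st'] := eqVneq s t; first exact: mixed_yy.
  apply: van; [exact: lt_le_trans p1|by rewrite lt_neqAle pq'|
    exact: le_lt_trans x1K|exact: lt_le_trans s1|by rewrite lt_neqAle st'|
    exact: le_lt_trans y1K|].
  move=> x y /andP[px xq] /andP[sy yt] [|[xu yv]].
    apply: av; first by rewrite (le_trans p1 px) (le_trans xq q1).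
    by rewrite (le_trans s1 sy) (le_trans yt t1).
  rewrite xu in px xq; rewrite yv in sy yt.
  case: far => [[] /eqP|[]|[]]; rewrite ?(negbTE pq') ?(negbTE st') //.
  - by rewrite ltNge xq.
  - by rewrite ltNge px.
  - by rewrite ltNge yt.
  - by rewrite ltNge sy.
have small e : 0 < e -> e <= d -> `|mixed D x0 x1 y0 y1| <= 8 * C * e.
  move=> e0 ed.
  (* The small square is clipped to the rectangle, since (u, v) may lie on a side. Each piece cut
     off is then either degenerate or strictly away from the point: this is the content of [a4],
     [b4], [c4] and [h4]. *)
  set a := Num.max x0 (u - e); set b := Num.min x1 (u + e).
  set c := Num.max y0 (v - e); set h := Num.min y1 (v + e).
  have ue : u - e < u by rewrite ltrBlDr ltrDl.
  have ve : v - e < v by rewrite ltrBlDr ltrDl.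
  have ue' : u < u + e by rewrite ltrDl.
  have ve' : v < v + e by rewrite ltrDl.
  have [a1 a2] : x0 <= a /\ u - e <= a by rewrite !le_max !lexx orbT.
  have a3 : a <= u by rewrite ge_max x0u ltW.
  have a4 : x0 = a \/ a < u.
    by rewrite /a; case: (leP x0 (u - e)) => _; [right|left].
  have [b1 b2] : b <= x1 /\ b <= u + e by rewrite !ge_min !lexx orbT.
  have b3 : u <= b by rewrite le_min ux1 ltW.
  have b4 : b = x1 \/ u < b.
    by rewrite /b; case: (leP x1 (u + e)) => _; [left|right].
  have [c1 c2] : y0 <= c /\ v - e <= c by rewrite !le_max !lexx orbT.
  have c3 : c <= v by rewrite ge_max y0v ltW.
  have c4 : y0 = c \/ c < v.
    by rewrite /c; case: (leP y0 (v - e)) => _; [right|left].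
  have [h1 h2] : h <= y1 /\ h <= v + e by rewrite !ge_min !lexx orbT.
  have h3 : v <= h by rewrite le_min vy1 ltW.
  have h4 : h = y1 \/ v < h.
    by rewrite /h; case: (leP y1 (v + e)) => _; [left|right].
  have ab : a < b.
    rewrite lt_min !gt_max x01 (lt_le_trans ue ux1) (le_lt_trans x0u ue') /=.
    exact: lt_trans ue'.
  have ch : c < h.
    rewrite lt_min !gt_max y01 (lt_le_trans ve vy1) (le_lt_trans y0v ve') /=.
    exact: lt_trans ve'.
  have Za : mixed D x0 a y0 y1 = 0.
    apply: (zero _ _ _ _ (lexx _) a1 (le_trans a3 ux1) (lexx _) (ltW y01) (lexx _)).
    by case: a4 => ?; [constructor 1; left|constructor 2; left].
  have Zb : mixed D b x1 y0 y1 = 0.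
    apply: (zero _ _ _ _ (le_trans x0u b3) b1 (lexx _) (lexx _) (ltW y01) (lexx _)).
    by case: b4 => ?; [constructor 1; left|constructor 2; right].
  have Zc : mixed D a b y0 c = 0.
    apply: (zero _ _ _ _ a1 (ltW ab) b1 (lexx _) c1 (le_trans c3 vy1)).
    by case: c4 => ?; [constructor 1; right|constructor 3; left].
  have Zh : mixed D a b h y1 = 0.
    apply: (zero _ _ _ _ a1 (ltW ab) b1 (le_trans y0v h3) h1 (lexx _)).
    by case: h4 => ?; [constructor 1; right|constructor 3; right].
  rewrite (mixed_split_x D a) (mixed_split_x D b a).
  rewrite (mixed_split_y D c a b) (mixed_split_y D h a b c).
  rewrite Za Zb Zc Zh !add0r !addr0.
  have Ka := lt_le_trans Kx0 a1; have bK := le_lt_trans b1 x1K.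
  have Kc := lt_le_trans Ky0 c1; have hK := le_lt_trans h1 y1K.
  have [xi [eta [xiP etaP ->]]] := mixed_MVT dA dB Ka ab bK Kc ch hK.
  have bd' x y : a <= x <= b -> c <= y <= h -> `|P x y| <= C /\ `|Q x y| <= C.
    move=> /andP[ax xb] /andP[cy yh]; apply: bd; apply: le_trans ed.
      by rewrite ler_distl (le_trans a2 ax) (le_trans xb b2).
    by rewrite ler_distl (le_trans c2 cy) (le_trans yh h2).
  have bndP y : c <= y <= h -> `|P xi y| <= C by move=> /(bd' _ _ xiP)[].
  have bndQ x : a <= x <= b -> `|Q x eta| <= C.
    by move=> /bd' /(_ etaP)[].
  have n1 : `|P xi c - P xi h| <= C + C.
    by rewrite (le_trans (ler_normB _ _)) // lerD // bndP // lexx ltW.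
  have n2 : `|Q b eta - Q a eta| <= C + C.
    by rewrite (le_trans (ler_normB _ _)) // lerD // bndQ // lexx ltW.
  have ba0 : 0 <= b - a by rewrite subr_ge0 ltW.
  have hc0 : 0 <= h - c by rewrite subr_ge0 ltW.
  have ba : b - a <= 2 * e.
    have -> : 2 * e = (u + e) - (u - e) by ring.
    exact: lerB.
  have hc : h - c <= 2 * e.
    have -> : 2 * e = (v + e) - (v - e) by ring.
    exact: lerB.
  rewrite (le_trans (ler_normD _ _)) // !normrM (ger0_norm ba0) (ger0_norm hc0).
  have -> : 8 * C * e = 2 * e * (C + C) + 2 * e * (C + C) by ring.
  by apply: lerD; apply: ler_pM.
apply/eqP; rewrite -normr_eq0; apply/negP => /negP m0.
have m_gt0 : 0 < `|mixed D x0 x1 y0 y1| by rewrite lt_neqAle eq_sym m0 normr_ge0.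
set m := `|_| in m_gt0 small *.
(* Makes 8 C e smaller than m; the [+ 1] covers C = 0. *)
set e := Num.min d (m / (16 * (C + 1))).
have q0 : 0 < m / (16 * (C + 1)) by rewrite divr_gt0 // mulr_gt0 //; lra.
have e0 : 0 < e by rewrite lt_min d0.
have := small e e0; rewrite ge_min lexx => /(_ isT).
have : e <= m / (16 * (C + 1)) by rewrite ge_min lexx orbT.
rewrite ler_pdivlMr; last by rewrite mulr_gt0 //; lra.
have : 0 <= C * e by rewrite mulr_ge0 // ltW.
nra.
Qed.

End RemovablePoints.

(** * Holomorphic functions of one variable *)

Section ComplexModulus.
Variable R : realType.
Local Notation C := (Cplx R).
Implicit Types z w : C.

Lemma normCE z : `|z| = toC (modC z).
Proof. by rewrite /modC [`|z|](@normc_def R z). Qed.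

Lemma modCE z : modC z = Num.sqrt (reC z ^+ 2 + imC z ^+ 2).
Proof. by rewrite /modC [`|z|](@normc_def R z). Qed.

Lemma ltr_toC (a b : R) : (toC a < toC b) = (a < b).
Proof. exact: (@ltcR R a b). Qed.

Lemma ler_toC (a b : R) : (toC a <= toC b) = (a <= b).
Proof. exact: (@lecR R a b). Qed.

Lemma toC_inj : injective (@toC R).
Proof. by move=> a b []. Qed.

Lemma toCM (a b : R) : toC (a * b) = toC a * toC b.
Proof. exact: (rmorphM (real_complex R)). Qed.

Lemma toCD (a b : R) : toC (a + b) = toC a + toC b.
Proof. exact: (rmorphD (real_complex R)). Qed.

Lemma toCX (a : R) k : toC (a ^+ k) = toC a ^+ k.
Proof. exact: (rmorphXn (real_complex R)). Qed.

Lemma gt0_toCP (e : C) : 0 < e -> exists2 r : R, 0 < r & e = toC r.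
Proof.
case: e => a b; rewrite (@ltcE R) /= => /andP[/eqP b0 a0].
by exists a => //; rewrite /toC -b0.
Qed.

Lemma modC_ge0 z : 0 <= modC z.
Proof. by rewrite modCE sqrtr_ge0. Qed.
Hint Resolve modC_ge0 : core.

Lemma modCM z w : modC (z * w) = modC z * modC w.
Proof. by apply: toC_inj; rewrite toCM -!normCE normrM. Qed.

Lemma modCX z k : modC (z ^+ k) = modC z ^+ k.
Proof. by apply: toC_inj; rewrite toCX -!normCE normrX. Qed.

Lemma modC_eq0 z : (modC z == 0) = (z == 0).
Proof. by rewrite -(normr_eq0 z) normCE; apply/eqP/eqP => [->//|/toC_inj]. Qed.

Lemma modC_gt0 z : (0 < modC z) = (z != 0).
Proof. by rewrite lt_neqAle modC_ge0 andbT eq_sym modC_eq0. Qed.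

Lemma modC0 : modC (0 : C) = 0.
Proof. by apply/eqP; rewrite modC_eq0. Qed.

Lemma modC1 : modC (1 : C) = 1.
Proof. by apply: toC_inj; rewrite -normCE normr1. Qed.

Lemma modCN z : modC (- z) = modC z.
Proof. by rewrite /modC normrN. Qed.

Lemma modCV z : modC z^-1 = (modC z)^-1.
Proof.
have [->|z0] := eqVneq z 0; first by rewrite invr0 modC0 invr0.
have mz : modC z != 0 by rewrite modC_eq0.
by apply: (mulfI mz); rewrite -modCM !divff // modC1.
Qed.

Lemma modCD z w : modC (z + w) <= modC z + modC w.
Proof. by rewrite -ler_toC toCD -!normCE ler_normD. Qed.

Lemma modCB z w : modC (z - w) <= modC z + modC w.
Proof. by rewrite -(modCN w) modCD. Qed.

Lemma modC_dist z w : modC (z - w) = modC (w - z).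
Proof. by rewrite /modC distrC. Qed.

Lemma modC_toC (a : R) : modC (toC a) = `|a|.
Proof. by rewrite modCE /= expr0n /= addr0 sqrtr_sqr. Qed.

Lemma modC_sqr z : modC z ^+ 2 = reC z ^+ 2 + imC z ^+ 2.
Proof. by rewrite modCE sqr_sqrtr // addr_ge0 // sqr_ge0. Qed.

Lemma Re_le_modC z : `|reC z| <= modC z.
Proof. by rewrite modCE -sqrtr_sqr ler_wsqrtr // lerDl sqr_ge0. Qed.

Lemma Im_le_modC z : `|imC z| <= modC z.
Proof. by rewrite modCE -sqrtr_sqr ler_wsqrtr // lerDr sqr_ge0. Qed.

Lemma modC_le_ReIm z : modC z <= `|reC z| + `|imC z|.
Proof.
have h : 0 <= `|reC z| + `|imC z| by rewrite addr_ge0.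
rewrite -(ler_pXn2r (n := 2)) ?nnegrE // modC_sqr sqrrD !real_normK ?num_real //.
by rewrite addrAC lerDl mulrn_wge0 // mulr_ge0.
Qed.

Lemma reCD z w : reC (z + w) = reC z + reC w.
Proof. by case: z w => [a b] [c d]. Qed.
Lemma imCD z w : imC (z + w) = imC z + imC w.
Proof. by case: z w => [a b] [c d]. Qed.
Lemma reCN z : reC (- z) = - reC z. Proof. by case: z. Qed.
Lemma imCN z : imC (- z) = - imC z. Proof. by case: z. Qed.
Lemma reCM z w : reC (z * w) = reC z * reC w - imC z * imC w.
Proof. by case: z w => [a b] [c d]. Qed.
Lemma imCM z w : imC (z * w) = reC z * imC w + imC z * reC w.
Proof. by case: z w => [a b] [c d]. Qed.

Lemma cvgCP (T : Type) (F : set_system T) {FF : Filter F} (f : T -> C) z :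
  f @ F --> z <->
  forall e : R, 0 < e -> \forall t \near F, modC (f t - z) < e.
Proof.
split=> [/cvgrPdist_lt H e e0|H].
  have te : 0 < toC e by rewrite (ltr_toC 0).
  have := H _ te; apply: filterS => t.
  by rewrite distrC normCE ltr_toC.
apply/cvgrPdist_lt => e /gt0_toCP[r r0 ->].
by have := H _ r0; apply: filterS => t; rewrite distrC normCE ltr_toC.
Qed.

Lemma nbhsCP z (A : set C) : nbhs z A <->
  exists2 d : R, 0 < d & forall w, modC (w - z) < d -> A w.
Proof.
split=> [/nbhs_ballP [e /gt0_toCP[r r0 ->] H]|[d d0 H]].
  by exists r => // w wz; apply: H; rewrite -ball_normE /= distrC normCE ltr_toC.
apply/nbhs_ballP; exists (toC d); first by rewrite /= (ltr_toC 0).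
by move=> w; rewrite -ball_normE /= distrC normCE ltr_toC; exact: H.
Qed.

Lemma continuousCP (u : C -> C) z : {for z, continuous u} <->
  forall e : R, 0 < e -> exists2 d : R, 0 < d &
    forall w, modC (w - z) < d -> modC (u w - u z) < e.
Proof.
have cE := @cvgCP _ (nbhs z) _ u (u z).
split=> [/cE H e e0|H]; first by apply/nbhsCP; exact: H.
by apply/cE => e e0; apply/nbhsCP; exact: H.
Qed.

Lemma deriveC_approx (V : normedModType C) (u : V -> C) (x v : V) :
  derivable u x v ->
  forall e : R, 0 < e -> exists2 d : R, 0 < d & forall h : C, modC h < d ->
    modC (u (x + h *: v) - u x - 'D_v u x * h) <= e * modC h.
Proof.
move=> du e e0.
have /cvgCP /(_ e e0) /nbhsCP[d d0 near] :
  h^-1 *: ((u \o shift x) (h *: v) - u x) @[h --> 0^'] --> 'D_v u x by exact: du.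
exists d => // h hd.
have [->|h0] := eqVneq h 0.
  by rewrite scale0r addr0 subrr mulr0 subr0 modC0 mulr0.
have := near h; rewrite subr0 => /(_ hd h0) /= /ltW.
rewrite (addrC _ x) [_ *: _]mulrC -(ler_pM2r (x := modC h)) ?modC_gt0 // -modCM.
by rewrite mulrBl divfK.
Qed.

Lemma derivableC_approx (u : C -> C) z : derivable u z 1 ->
  exists l : C, forall e : R, 0 < e -> exists2 d : R, 0 < d &
    forall w, modC (w - z) < d ->
      modC (u w - u z - l * (w - z)) <= e * modC (w - z).
Proof.
move=> du; exists ('D_1 u z) => e /(deriveC_approx du)[d d0 near].
exists d => // w /near.
by have -> : z + (w - z) *: (1 : C) = w by rewrite [_ *: _]mulr1 addrC subrK.
Qed.

Lemma continuousCP_comp (T : topologicalType) (u : T -> C) (x : T) :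
  {for x, continuous u} ->
  {for x, continuous (@reC R \o u)} /\ {for x, continuous (@imC R \o u)}.
Proof.
move=> /(@cvgCP _ (nbhs x) _ u (u x)).1 H; split; apply/cvgrPdist_lt => e e0; have := H e e0;
  apply: filterS => t /=; apply: le_lt_trans.
- by rewrite distrC -reCN -reCD Re_le_modC.
- by rewrite distrC -imCN -imCD Im_le_modC.
Qed.

Lemma Complex_continuousl (y x : R) : {for x, continuous (fun t => Complex t y : C)}.
Proof.
apply/(@cvgCP _ (nbhs _)) => e e0; near=> t.
apply: (le_lt_trans (modC_le_ReIm _)) => /=.
rewrite subrr normr0 addr0 distrC.
by near: t; apply: nbhsx_ballx.
Unshelve. all: by end_near. Qed.

Lemma Complex_continuousr (x y : R) : {for y, continuous (fun t => Complex x t : C)}.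
Proof.
apply/(@cvgCP _ (nbhs _)) => e e0; near=> t.
apply: (le_lt_trans (modC_le_ReIm _)) => /=.
rewrite subrr normr0 add0r distrC.
by near: t; apply: nbhsx_ballx.
Unshelve. all: by end_near. Qed.

End ComplexModulus.

(** * The maximum principle on squares, with a constant *)

Section MaximumPrinciple.
Variable R : realType.
Local Notation C := (Cplx R).

(** With v = Q + i P, the form P dx + Q dy is the imaginary part of v dz, and closedness is a
    Cauchy-Riemann equation: the shared coefficient is the real part of the derivative of v. *)
Lemma derivable_closed_form (v : C -> C) (x y : R) :
  derivable v (Complex x y : C) 1 ->
  closed_form_at (fun s t => imC (v (Complex s t)))
                 (fun s t => reC (v (Complex s t))) x y.
Proof.
move=> /derivableC_approx[l H]; exists (imC l), (reC l), (- imC l) => e e0.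
have [d d0 near] := H e e0; exists (d / 2); first by rewrite divr_gt0.
move=> s t sx ty; set z : C := Complex x y; set w : C := Complex s t.
have reE : reC (w - z) = s - x by rewrite reCD reCN.
have imE : imC (w - z) = t - y by rewrite imCD imCN.
have wz := modC_le_ReIm (w - z); rewrite reE imE in wz.
have /near : modC (w - z) < d.
  by apply: (le_lt_trans wz); rewrite (splitr d) ltrD.
set err := _ - _ - _ => er.
have {}er : modC err <= e * (`|s - x| + `|t - y|).
  by apply: (le_trans er); rewrite ler_pM2l.
split; apply: le_trans er.
  suff <- : imC err =
    imC (v w) - imC (v z) - (imC l * (s - x) + reC l * (t - y)) by exact: Im_le_modC.
  by rewrite /err !(imCD, imCN, imCM, reCD, reCN) /w /z /=; ring.
suff <- : reC err =
  reC (v w) - reC (v z) - (reC l * (s - x) + - imC l * (t - y)) by exact: Re_le_modC.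
by rewrite /err !(reCD, reCN, reCM, imCD, imCN) /w /z /=; ring.
Qed.

Lemma reC_div (c : C) (x y : R) :
  reC (c / Complex x y) = (reC c * x + imC c * y) / (x ^+ 2 + y ^+ 2).
Proof. by case: c => a b; rewrite reCM /=; ring. Qed.

Lemma imC_div (c : C) (x y : R) :
  imC (c / Complex x y) = (imC c * x - reC c * y) / (x ^+ 2 + y ^+ 2).
Proof. by case: c => a b; rewrite imCM /=; ring. Qed.

(** The quotient is completed at [a] by the derivative of u. At [a] this yields continuity only,
    which is why Goursat's theorem has to tolerate exceptional points. *)
Lemma difference_quotient (u : C -> C) (a : C) : derivable u a 1 ->
  exists v : C -> C,
    [/\ forall z, z != a -> v z = (u z - u a) / (z - a),
        {for a, continuous v},
        forall z, z != a -> {for z, continuous u} -> {for z, continuous v} &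
        forall z, z != a -> derivable u z 1 -> derivable v z 1].
Proof.
move=> /derivableC_approx[l lP].
pose v z : C := if z == a then l else (u z - u a) / (z - a).
exists v.
have vE z : z != a -> v z = (u z - u a) / (z - a) by rewrite /v => /negbTE ->.
have near_vE z : z != a -> {near z, (fun t => (u t - u a) / (t - a)) =1 v}.
  move=> za; have : \forall t \near z, t != a.
    apply/nbhsCP; exists (modC (z - a)); first by rewrite modC_gt0 subr_eq0.
    by move=> t; apply: contraTneq => ->; rewrite modC_dist ltxx.
  by apply: filterS => t /vE.
split; first exact: vE.
- apply/continuousCP => e e0.
  have e20 : 0 < e / 2 by rewrite divr_gt0.
  have [d d_gt0 near] := lP _ e20; exists d => // t ta.
  rewrite /v eqxx; case: eqVneq => [_|tna]; first by rewrite subrr modC0.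
  have ta0 : t - a != 0 by rewrite subr_eq0.
  have := near t ta.
  have -> : u t - u a - l * (t - a) = ((u t - u a) / (t - a) - l) * (t - a).
    by rewrite mulrBl divfK.
  rewrite modCM ler_pM2r ?modC_gt0 // => /le_lt_trans; apply.
  by rewrite ltr_pdivrMr // ltr_pMr // ltr1n.
- move=> z za cu.
  have za0 : z - a != 0 by rewrite subr_eq0.
  have H1 : {for z, continuous (u - cst (u a))}.
    by apply: (@continuousB _ _ _ u (cst (u a))); [exact: cu|exact: cst_continuous].
  have H2 : {for z, continuous (fun t : C => (t - a)^-1)}.
    have H20 : {for z, continuous (fun t : C => t - a)}.
      by apply: (@continuousB _ _ _ id (cst a)); [exact: cvg_id|exact: cst_continuous].
    exact: (@continuousV _ _ (fun t : C => t - a) z za0 H20).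
  rewrite /prop_for /continuous_at (vE z za).
  exact: cvg_trans (near_eq_cvg (near_vE z za)) (cvgM H1 H2).
- move=> z za du; apply: near_eq_derivable (near_vE z za) _.
  apply: (@derivableM _ _ (u - cst (u a)) (fun t => (t - a)^-1)).
    by apply: (@derivableB _ _ _ u (cst (u a))); [exact: du|exact: derivable_cst].
  have za0 : z - a != 0 by rewrite subr_eq0.
  have D : derivable (fun t : C => t - a) z 1.
    by apply: (@derivableB _ _ _ id (cst a)); [exact: derivable_id|exact: derivable_cst].
  exact: (@derivableV _ _ (fun t : C => t - a) z 1 za0 D).
Qed.

Definition on_square (rho : R) (z : C) :=
  [/\ `|reC z| <= rho, `|imC z| <= rho & `|reC z| = rho \/ `|imC z| = rho].

(* Otherwise w = w(0) q with |q| < 1/2 on the boundary, and the imaginary part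
   of the integral of (q - 1) / z, which vanishes by Goursat's theorem, would be
   the integral of a function that is negative at every point. *)
Lemma center_le_boundary (w : C -> C) (rho K m : R) (p : C) :
  0 < rho -> rho < K -> p != 0 ->
  (forall x y, `|x| <= K -> `|y| <= K -> {for (Complex x y : C), continuous w}) ->
  (forall x y, `|x| <= K -> `|y| <= K -> (Complex x y : C) != p ->
     derivable w (Complex x y : C) 1) ->
  (forall z, on_square rho z -> modC (w z) <= m) -> modC (w 0) <= 2 * m.
Proof.
move=> rho0 rhoK p0 cw dw bw; rewrite leNgt; apply/negP => w0m.
have K0 : 0 < K by exact: lt_trans rhoK.
have m0 : 0 <= m.
  apply: (le_trans (modC_ge0 (w (Complex rho 0)))); apply: bw.
  by split => /=; rewrite ?normr0 ?(ltW rho0) ?gtr0_norm //; left.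
have w0 : w 0 != 0 by rewrite -modC_gt0 (le_lt_trans _ w0m) // mulr_ge0.
pose q z := w z / w 0.
have qb z : on_square rho z -> `|reC (q z)| < 1 / 2 /\ `|imC (q z)| < 1 / 2.
  move=> /bw wm.
  have qm : modC (q z) < 1 / 2.
    rewrite /q modCM modCV ltr_pdivrMr ?modC_gt0 //; lra.
  by split; apply: le_lt_trans qm; [exact: Re_le_modC|exact: Im_le_modC].
have cq x y : `|x| <= K -> `|y| <= K -> {for (Complex x y : C), continuous q}.
  move=> xK yK; apply: (@continuousM _ _ w (cst (w 0)^-1)); last exact: cst_continuous.
  exact: cw.
have dq x y : `|x| <= K -> `|y| <= K -> (Complex x y : C) != p ->
    derivable q (Complex x y : C) 1.
  by move=> xK yK xyp; apply: derivableM; [exact: dw|exact: derivable_cst].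
have d0 : derivable q 0 1 by apply: dq; rewrite ?normr0 ?ltW // eq_sym.
have q0 : q 0 = 1 by rewrite /q divff.
have [v [vE cv0 cv1 dv1]] := difference_quotient d0.
have {}vE z : z != 0 -> v z = (q z - 1) / z by move=> /vE; rewrite q0 subr0.
have cv x y : `|x| <= K -> `|y| <= K -> {for (Complex x y : C), continuous v}.
  move=> xK yK; have [->//|z0] := eqVneq (Complex x y : C) 0.
  by apply: cv1 z0 _; exact: cq.
have dv x y : `|x| <= K -> `|y| <= K -> (Complex x y : C) != p ->
    (Complex x y : C) != 0 -> derivable v (Complex x y : C) 1.
  by move=> xK yK xyp xy0; apply: dv1 xy0 _; exact: dq.
pose P x y := imC (v (Complex x y)); pose Q x y := reC (v (Complex x y)).
have cP x y : `|x| <= K -> `|y| <= K -> {for x, continuous (P ^~ y)}.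
  move=> xK yK; apply: (@continuous_comp _ _ _ (fun t => Complex t y : C)
    (@imC R \o v)); first exact: Complex_continuousl.
  exact: (continuousCP_comp (cv _ _ xK yK)).2.
have cQ x y : `|x| <= K -> `|y| <= K -> {for y, continuous (Q x)}.
  move=> xK yK; apply: (@continuous_comp _ _ _ (fun t => Complex x t : C)
    (@reC R \o v)); first exact: Complex_continuousr.
  exact: (continuousCP_comp (cv _ _ xK yK)).1.
have /choice[A AP] : forall y, exists F : R -> R, `|y| <= K ->
    forall x, - K < x < K -> is_derive x 1 F (P x y).
  move=> y; have [yK|yK] := leP `|y| K; last first.
    by exists id.
  have [|F FP] := @primitive_ex R K (P ^~ y); last by exists F.
  by move=> x; rewrite -ler_norml => xK; exact: cP.
have /choice[B BP] : forall x, exists F : R -> R, `|x| <= K ->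
    forall y, - K < y < K -> is_derive y 1 F (Q x y).
  move=> x; have [xK|xK] := leP `|x| K; last first.
    by exists id.
  have [|F FP] := @primitive_ex R K (Q x); last by exists F.
  by move=> y; rewrite -ler_norml => yK; exact: cQ.
pose A' x y := A y x.
have dA x y : - K < x < K -> - K < y < K -> is_derive x 1 (A' ^~ y) (P x y).
  by move=> xK yK; apply: AP => //; rewrite ler_norml !ltW //; case/andP: yK.
have dB x y : - K < x < K -> - K < y < K -> is_derive y 1 (B x) (Q x y).
  by move=> xK yK; apply: BP => //; rewrite ler_norml !ltW //; case/andP: xK.
have bounded_near x y : `|x| <= K -> `|y| <= K ->
    exists2 d : R, 0 < d & exists c : R, forall s t, `|s - x| <= d ->
      `|t - y| <= d -> `|P s t| <= c /\ `|Q s t| <= c.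
  move=> xK yK; have /continuousCP /(_ 1 ltr01)[d d_gt0 near] := cv x y xK yK.
  exists (d / 3); first by rewrite divr_gt0.
  exists (modC (v (Complex x y)) + 1) => s t sx ty.
  have st : modC ((Complex s t : C) - Complex x y) < d.
    apply: (le_lt_trans (modC_le_ReIm _)); rewrite !(reCD, imCD, reCN, imCN) /=.
    by apply: (le_lt_trans (lerD sx ty)); lra.
  have vst : modC (v (Complex s t)) <= modC (v (Complex x y)) + 1.
    rewrite -[v (Complex s t)](subrK (v (Complex x y))) addrC.
    by apply: (le_trans (modCD _ _)); rewrite lerD2l ltW // near.
  by split; apply: le_trans vst; [exact: Im_le_modC|exact: Re_le_modC].
have inK a b u : - K < a -> b < K -> a <= u <= b -> `|u| <= K.
  move=> Ka bK /andP[au ub].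
  by rewrite ler_norml (le_trans (ltW Ka) au) (le_trans ub (ltW bK)).
(* There are two exceptional points: 0, where v is a completed quotient, and p, where w is only
   assumed continuous. Continuity of v makes P and Q bounded near each, so both can be removed. *)
have van2 : mixed_vanishes K A' B
    (fun x y => (False \/ x = 0 /\ y = 0) \/ x = reC p /\ y = imC p).
  move=> x0 x1 y0 y1 Kx0 x01 x1K Ky0 y01 y1K av.
  apply: (@goursat R K P Q A' B dA dB) => // x y xI yI.
  apply: derivable_closed_form; apply: dv.
  - exact: inK xI.
  - exact: inK yI.
  - by apply/eqP => E; apply: (av _ _ xI yI); right; rewrite -E.
  - apply/eqP => E; apply: (av _ _ xI yI); left; right.
    by split; [exact: (congr1 (@reC R) E)|exact: (congr1 (@imC R) E)].
have van1 : mixed_vanishes K A' B (fun x y => False \/ x = 0 /\ y = 0).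
  have [/andP[pK1 pK2]|pK] := boolP ((`|reC p| <= K) && (`|imC p| <= K)).
    exact: (mixed_removable dA dB (bounded_near _ _ pK1 pK2) van2).
  move=> x0 x1 y0 y1 Kx0 x01 x1K Ky0 y01 y1K av.
  apply: van2 => // x y xI yI; case; first exact: av.
  move=> [Ex Ey]; rewrite Ex in xI; rewrite Ey in yI.
  by move: pK; rewrite (inK _ _ _ Kx0 x1K xI) (inK _ _ _ Ky0 y1K yI).
have van : mixed_vanishes K A' B (fun _ _ => False).
  by apply: (mixed_removable dA dB _ van1); apply: bounded_near;
    rewrite normr0 ltW.
have Kr : - K < - rho by rewrite ltrN2.
have rr : - rho < rho by rewrite gtrN.
have := van _ _ _ _ Kr rr rhoK Kr rr rhoK (fun _ _ _ _ => id).
have [xi [eta [xiP etaP ->]]] := mixed_MVT dA dB Kr rr rhoK Kr rr rhoK.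
rewrite -ler_norml in xiP; rewrite -ler_norml in etaP.
have nr : `|rho| = rho by rewrite gtr0_norm.
have rho_ne0 : rho == 0 = false by rewrite gt_eqF.
have sq_gt0 (a : R) : 0 < rho ^+ 2 + a ^+ 2.
  by rewrite ltr_wpDr ?sqr_ge0 // exprn_gt0.
(* On each side, the numerator of the real or imaginary part of (q - 1) / z is a main term larger
   than rho / 2 in absolute value ([qre]) plus a cross term of size at most rho / 2 ([prodb]). The
   main term decides the sign, and the four signs make both summands of the boundary integral
   negative. *)
have prodb (a s : R) : `|a| < 1 / 2 -> `|s| <= rho -> `|a * s| <= rho / 2.
  move=> a2 sr; rewrite normrM.
  have -> : rho / 2 = 1 / 2 * rho by lra.
  by rewrite ler_pM // ltW.
have qre (a : R) : `|a| < 1 / 2 -> (a - 1) * rho < - (rho / 2).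
  move=> /ltr_normlW a2; have -> : - (rho / 2) = - (1 / 2) * rho by lra.
  by rewrite ltr_pM2r //; lra.
have ne0r s : (Complex rho s : C) != 0.
  by apply/eqP => -[/eqP]; rewrite rho_ne0.
have ne0l s : (Complex (- rho) s : C) != 0.
  by apply/eqP => -[/eqP]; rewrite oppr_eq0 rho_ne0.
have ne0t s : (Complex s rho : C) != 0.
  by apply/eqP => -[_ /eqP]; rewrite rho_ne0.
have ne0b s : (Complex s (- rho) : C) != 0.
  by apply/eqP => -[_ /eqP]; rewrite oppr_eq0 rho_ne0.
have Qr : Q rho eta < 0.
  rewrite /Q vE // reC_div pmulr_llt0 ?invr_gt0 ?sq_gt0 //.
  have [] := qb (Complex rho eta); first by split; rewrite /= ?nr //; left.
  move=> /qre h1 /prodb /(_ etaP); rewrite ler_norml => /andP[_ h2].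
  by rewrite reCD imCD reCN imCN /= oppr0 addr0; lra.
have Ql : 0 < Q (- rho) eta.
  rewrite /Q vE // reC_div pmulr_lgt0 ?invr_gt0 ?sqrrN ?sq_gt0 //.
  have [] := qb (Complex (- rho) eta).
    by split; rewrite /= ?normrN ?nr //; left.
  move=> /qre h1 /prodb /(_ etaP); rewrite ler_norml => /andP[h2 _].
  by rewrite reCD imCD reCN imCN /= oppr0 addr0 mulrN; lra.
have Pb : P xi (- rho) < 0.
  rewrite /P vE // imC_div pmulr_llt0 ?invr_gt0 ?sqrrN 1?addrC ?sq_gt0 //.
  have [] := qb (Complex xi (- rho)).
    by split; rewrite /= ?normrN ?nr //; right.
  move=> /qre h1 /prodb /(_ xiP); rewrite ler_norml => /andP[_ h2].
  by rewrite reCD imCD reCN imCN /= oppr0 addr0 mulrN; lra.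
have Pt : 0 < P xi rho.
  rewrite /P vE // imC_div pmulr_lgt0 ?invr_gt0 1?addrC ?sq_gt0 //.
  have [] := qb (Complex xi rho); first by split; rewrite /= ?nr //; right.
  move=> /qre h1 /prodb /(_ xiP); rewrite ler_norml => /andP[h2 _].
  by rewrite reCD imCD reCN imCN /= oppr0 addr0; lra.
have rr0 : 0 < rho - - rho by lra.
have : (rho - - rho) * (P xi (- rho) - P xi rho) < 0 by rewrite pmulr_rlt0 //; lra.
have : (rho - - rho) * (Q rho eta - Q (- rho) eta) < 0 by rewrite pmulr_rlt0 //; lra.
set a := _ * _; set b := _ * _ => a0 b0 /eqP.
by rewrite lt_eqF // -[0]addr0 ltrD.
Qed.
End MaximumPrinciple.

(** * Holomorphic functions of several variables *)

Section VectorNorm.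
Variables (R : realType) (n : nat).
Local Notation C := (Cplx R).
Implicit Types v w z : 'rV[C]_n.

Definition modV v : R := reC `|v|.

Lemma normVE v : `|v| = toC (modV v).
Proof.
have := normr_ge0 v; rewrite /modV; case: `|v| => a b.
by rewrite (@lecE R) /= => /andP[/eqP b0 _]; rewrite b0.
Qed.

Lemma modV_ge0 v : 0 <= modV v.
Proof. by rewrite -ler_toC -normVE normr_ge0. Qed.

Lemma modV0 : modV 0 = 0.
Proof. by rewrite /modV normr0. Qed.

Lemma modV_eq0 v : modV v = 0 -> v = 0.
Proof. by move=> v0; apply/eqP; rewrite -normr_eq0 normVE v0. Qed.

Lemma modVD v w : modV (v + w) <= modV v + modV w.
Proof. by rewrite -ler_toC toCD -!normVE ler_normD. Qed.

Lemma modVZ (a : C) v : modV (a *: v) = modC a * modV v.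
Proof. by apply: toC_inj; rewrite toCM -!normVE -normCE normrZ. Qed.

Lemma modV_ltP v (e : R) : 0 < e ->
  modV v < e <-> forall j, modC (v ord0 j) < e.
Proof.
move=> e0; have te : 0 < toC e by rewrite (ltr_toC 0).
have bE : ball (0 : 'rV[C]_n) (toC e) v <-> modV v < e.
  by rewrite -ball_normE /= sub0r normrN normVE ltr_toC.
rewrite -bE; split=> [[_ H] j|H].
  by have := H ord0 j; rewrite -ball_normE /= mxE sub0r normrN normCE ltr_toC.
split=> // i j; rewrite ord1 -ball_normE /= mxE sub0r normrN normCE ltr_toC.
exact: H.
Qed.

Lemma nbhsVP z (A : set 'rV[C]_n) : nbhs z A <->
  exists2 d : R, 0 < d & forall w, modV (w - z) < d -> A w.
Proof.
split=> [/nbhs_ballP [e /gt0_toCP[r r0 ->] H]|[d d0 H]].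
  by exists r => // w wz; apply: H; rewrite -ball_normE /= distrC normVE ltr_toC.
apply/nbhs_ballP; exists (toC d); first by rewrite /= (ltr_toC 0).
by move=> w; rewrite -ball_normE /= distrC normVE ltr_toC; exact: H.
Qed.

Lemma derivable_line (u : 'rV[C]_n -> C) z v (a : C) :
  derivable u (z + a *: v) v -> derivable (fun b : C => u (z + b *: v)) a 1.
Proof.
rewrite /derivable.
suff -> : (fun h : C => h^-1 *: ((u \o shift (z + a *: v)) (h *: v) - u (z + a *: v)))
  = (fun h : C => h^-1 *: (((fun b : C => u (z + b *: v)) \o shift a) (h *: 1)
      - u (z + a *: v))) by [].
apply/funext => h /=; congr (_ *: (u _ - _)).
by rewrite [h *: 1]mulr1 scalerDl addrCA.
Qed.

Lemma Complex_small (x y K : R) : `|x| <= K -> `|y| <= K ->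
  modC (Complex x y : C) <= 2 * K.
Proof.
move=> xK yK; apply: (le_trans (modC_le_ReIm _)).
by rewrite mulr_natl mulr2n lerD.
Qed.

(** Cauchy's estimate without an integral formula: on the complex line through y and z, the maximum
    principle is applied to the difference quotient of u at y, on a square centered at z. *)
Lemma lipschitz_bound (u : 'rV[C]_n -> C) z0 (r M : R) : 0 < r ->
  (forall z, modV (z - z0) < 2 * r -> differentiable u z /\ modC (u z) <= M) ->
  forall y z, modV (y - z0) < r -> modV (z - y) <= r / 8 ->
    modC (u z - u y) <= 32 * M / r * modV (z - y).
Proof.
move=> r0 Hu y z yz0 zy.
have M0 : 0 <= M.
  have [|_] := Hu z0; last exact: le_trans (modC_ge0 _).
  by rewrite subrr modV0 mulr_gt0.
set D := modV (z - y) in zy *.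
have [D0|D0] := eqVneq D 0.
  by move/modV_eq0/eqP: (D0); rewrite subr_eq0 => /eqP ->; rewrite subrr modC0 D0 mulr0.
have D_gt0 : 0 < D by rewrite lt_neqAle eq_sym D0 modV_ge0.
(* On the line [y + a *: (z - y)], y is a = 0 and z is a = 1, and |a| < T keeps the point within r
   of y. The hypothesis on z says that T is at least 8. *)
pose T := r / D.
have T8 : 8 <= T by rewrite /T ler_pdivlMr // mulrC -ler_pdivlMr.
have TD : T * D = r by rewrite /T divfK.
pose U (a : C) := u (y + a *: (z - y)).
have HU a : modC a < T -> derivable U a 1 /\ modC (U a) <= M.
  move=> aT; have [|du bu] := Hu (y + a *: (z - y)).
    rewrite addrAC; apply: (le_lt_trans (modVD _ _)); rewrite modVZ.
    rewrite mulr_natl mulr2n ltrD // -TD ltr_pM2r //.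
  by split => //; apply: derivable_line; exact: diff_derivable.
have T0 : 0 < T by lra.
have [|dU0 bU0] := HU 0; first by rewrite modC0.
have [w [wE cw0 cw dw]] := difference_quotient dU0.
pose W (b : C) := w (1 + b).
have in_T x yy : `|x| <= 3 * T / 8 -> `|yy| <= 3 * T / 8 ->
    modC (1 + (Complex x yy : C)) < T.
  move=> xK yK; apply: (le_lt_trans (modCD _ _)); rewrite modC1.
  have := Complex_small xK yK; lra.
have cont_shift (b : C) : {for b, continuous (fun t : C => 1 + t)}.
  apply/continuousCP => e e0; exists e => // t.
  by rewrite opprD addrACA subrr add0r.
have Wb : modC (W 0) <= 2 * (16 * M / T).
  (* The square is centered at a = 1, that is b = 0. On its boundary |a| >= T / 4 - 1 >= T / 8,
     whence the bound 2 M / (T / 8). The exceptional point b = -1 is a = 0, where the quotient is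
     only continuous. *)
  apply: (@center_le_boundary R W (T / 4) (3 * T / 8) _ (- 1)); [lra|lra| | | |].
  - by rewrite oppr_eq0 oner_eq0.
  - move=> x yy xK yK; have [dU _] := HU _ (in_T x yy xK yK).
    apply: (@continuous_comp _ _ _ (fun t : C => 1 + t) w); first exact: cont_shift.
    have [->|ne0] := eqVneq (1 + (Complex x yy : C)) 0; first exact: cw0.
    apply: cw ne0 _; apply: differentiable_continuous.
    by apply/derivable1_diffP.
  - move=> x yy xK yK ne1; have [dU _] := HU _ (in_T x yy xK yK).
    have ne0 : 1 + (Complex x yy : C) != 0 by rewrite addrC addr_eq0.
    have := dw _ ne0 dU.
    rewrite /derivable.
    suff -> : (fun h : C => h^-1 *: ((w \o shift (1 + (Complex x yy : C))) (h *: 1)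
        - w (1 + (Complex x yy : C)))) = (fun h : C => h^-1 *: ((W \o
        shift (Complex x yy : C)) (h *: 1) - W (Complex x yy : C))) by [].
    by apply/funext => h /=; rewrite /W addrCA.
  - move=> b [b1 b2 b3].
    have b_ge : T / 4 <= modC b.
      by case: b3 => <-; [exact: Re_le_modC|exact: Im_le_modC].
    have bT : modC (1 + b) < T.
      by case: b b1 b2 {b3 b_ge} => x yy /= b1 b2; apply: in_T; lra.
    have b1_ge : T / 8 <= modC (1 + b).
      have : modC b <= modC (1 + b) + modC (1 : C).
        by have := modCB (1 + b) 1; rewrite addrAC subrr add0r.
      rewrite modC1; lra.
    have ne0 : 1 + b != 0 by rewrite -modC_gt0; lra.
    rewrite /W wE // subr0 modCM modCV ler_pdivrMr; last by lra.
    have [_ bU] := HU _ bT.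
    have : modC (U (1 + b) - U 0) <= 2 * M.
      by apply: (le_trans (modCB _ _)); lra.
    move/le_trans; apply.
    have -> : 16 * M / T * modC (1 + b) = 2 * M * (modC (1 + b) / (T / 8)).
      by field; rewrite gt_eqF.
    by rewrite ler_peMr ?mulr_ge0 // ler_pdivlMr ?mul1r // divr_gt0.
have W0 : W 0 = u z - u y.
  rewrite /W addr0 wE ?oner_eq0 // subr0 divr1 /U scale1r scale0r addr0.
  by rewrite [y + _]addrC subrK.
rewrite -W0; apply: (le_trans Wb); rewrite le_eqVlt; apply/orP; left; apply/eqP.
by rewrite /T; field; rewrite D0 gt_eqF.
Qed.

(** Since f^k is divided out before the maximum principle is used, its constant 2 is paid once and
    not k times. Only the restriction of w to one complex line occurs, so derivability in the
    direction v suffices. *)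
Lemma vanishing_bound (u f w : 'rV[C]_n -> C) z v (rho K c M : R) (k : nat) :
  0 < rho -> rho < K -> 0 < c ->
  (forall a : C, modC a <= 2 * K -> derivable w (z + a *: v) v) ->
  (forall a : C, modC a <= 2 * K ->
     u (z + a *: v) = f (z + a *: v) ^+ k * w (z + a *: v)) ->
  (forall a : C, on_square rho a -> c <= modC (f (z + a *: v)) /\
     modC (u (z + a *: v)) <= M) ->
  modC (u z) <= 2 * M * (modC (f z) / c) ^+ k.
Proof.
move=> rho0 rhoK c0 dw uE bnd.
have K0 : 0 < K by exact: lt_trans rhoK.
pose W (a : C) := w (z + a *: v).
have wb : modC (W 0) <= 2 * (M / c ^+ k).
  (* W is derivable on the whole square, so any nonzero point can be passed as the exceptional
     one. *)
  apply: (@center_le_boundary R W rho K _ 1 rho0 rhoK); first exact: oner_neq0.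
  - move=> x y xK yK; apply: differentiable_continuous.
    apply/derivable1_diffP; apply: derivable_line; apply: dw.
    exact: Complex_small.
  - move=> x y xK yK _; apply: derivable_line; apply: dw.
    exact: Complex_small.
  - move=> a sa; have [ca Ma] := bnd a sa.
    have aK : modC a <= 2 * K.
      by case: a sa {ca Ma} => x y [/= xr yr _]; apply: Complex_small;
        apply: ltW; apply: le_lt_trans rhoK.
    rewrite ler_pdivlMr ?exprn_gt0 //; apply: le_trans Ma.
    have ck : c ^+ k <= modC (f (z + a *: v)) ^+ k.
      by rewrite lerXn2r ?nnegrE ?modC_ge0 // ltW.
    rewrite uE // modCM modCX mulrC; apply: ler_pM => //; last exact: modC_ge0.
    by rewrite exprn_ge0 // ltW.
have := uE 0; rewrite modC0 scale0r addr0 => -> //; last by rewrite mulr_ge0 // ltW.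
rewrite modCM modCX expr_div_n; move: wb; rewrite /W scale0r addr0 => wb.
have -> : 2 * M * (modC (f z) ^+ k / c ^+ k) = modC (f z) ^+ k * (2 * (M / c ^+ k)).
  by ring.
by rewrite ler_wpM2l // exprn_ge0 // modC_ge0.
Qed.

(** On the line through z0 itself, [dv0] gives |f| >= |l a| / 2 for small a. The Lipschitz bound
    carries half of this over to the parallel lines through nearby points, with the same square for
    all of them. *)
Lemma transverse_square (f : 'rV[C]_n -> C) z0 v (r M : R) : 0 < r ->
  (forall z, modV (z - z0) < 2 * r -> differentiable f z /\ modC (f z) <= M) ->
  f z0 = 0 -> 'd f z0 v != 0 ->
  exists rho K c d : R, [/\ 0 < rho, rho < K, 0 < c, 0 < d &
    forall z, modV (z - z0) < d ->
      (forall a : C, modC a <= 2 * K -> modV (z + a *: v - z0) < 2 * r) /\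
      (forall a : C, on_square rho a -> c <= modC (f (z + a *: v)))].
Proof.
move=> r0 Hf f0 dv0.
have [|df _] := Hf z0; first by rewrite subrr modV0 mulr_gt0.
have M0 : 0 <= M.
  have [|_] := Hf z0; last exact: le_trans (modC_ge0 _).
  by rewrite subrr modV0 mulr_gt0.
set l := 'd f z0 v in dv0.
have l0 : 0 < modC l by rewrite modC_gt0.
have [d1 d1_gt0 near] := deriveC_approx (@diff_derivable _ _ _ f _ v df)
  (divr_gt0 l0 (ltr0n R 2)).
rewrite deriveE // -/l f0 in near.
have V0 : 0 < modV v + 1 by rewrite ltr_wpDl // modV_ge0.
pose K := Num.min (d1 / 4) (r / (4 * (modV v + 1))).
have K0 : 0 < K by rewrite lt_min !divr_gt0 // mulr_gt0.
have Kd : K <= d1 / 4 by rewrite ge_min lexx.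
have Kr : K * (4 * (modV v + 1)) <= r.
  by rewrite -ler_pdivlMr ?mulr_gt0 // ge_min lexx orbT.
pose rho := K / 2.
have rho0 : 0 < rho by rewrite divr_gt0.
(* Half of the lower bound |l| rho / 2 on the line through z0; the other half pays for moving z0 to
   z, at distance less than [d]. *)
pose c := modC l * rho / 4.
have c0 : 0 < c by rewrite !mulr_gt0.
have cM : 0 < 32 * M / r + 1 by rewrite ltr_wpDl // divr_ge0 ?mulr_ge0 // ltW.
pose d := Num.min (r / 8) (c / (32 * M / r + 1)).
have d0 : 0 < d by rewrite lt_min (divr_gt0 r0) // (divr_gt0 c0).
have dr : d <= r / 8 by rewrite ge_min lexx.
have dc : (32 * M / r + 1) * d <= c.
  by rewrite mulrC -ler_pdivlMr // ge_min lexx orbT.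
exists rho, K, c, d; split => //; first by rewrite /rho; lra.
move=> z zz0.
have av (a : C) : modC a <= 2 * K -> modV (a *: v) <= r / 2.
  move=> aK; rewrite modVZ.
  have : modC a * modV v <= 2 * K * (modV v + 1).
    by apply: ler_pM; rewrite ?modC_ge0 ?modV_ge0 ?lerDl.
  lra.
split=> a.
  move=> /av aK; rewrite addrAC; apply: (le_lt_trans (modVD _ _)); lra.
move=> [a1 a2 a3].
have a_le : modC a <= 2 * rho.
  by case: a a1 a2 {a3} => x y; exact: Complex_small.
have a_ge : rho <= modC a.
  by case: a3 => <-; [exact: Re_le_modC|exact: Im_le_modC].
have aK : modC a <= 2 * K by move: a_le; rewrite /rho; lra.
have aa : modC a < d1 by move: a_le; rewrite /rho; lra.
have fa : 2 * c <= modC (f (z0 + a *: v)).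
  have := near a aa; rewrite subr0 => h.
  have : modC (l * a) <= modC (f (z0 + a *: v)) + modC (f (z0 + a *: v) - l * a).
    by rewrite -{1}[l * a](subKr (f (z0 + a *: v))) modCB.
  have : modC l * rho <= modC l * modC a by rewrite ler_pM2l.
  by rewrite modCM /c; lra.
have zE : z + a *: v - (z0 + a *: v) = z - z0 by rewrite opprD addrACA subrr addr0.
have lip : modC (f (z + a *: v) - f (z0 + a *: v)) <= 32 * M / r * modV (z - z0).
  rewrite -zE; apply: (lipschitz_bound r0 Hf).
    by rewrite addrAC subrr add0r; apply: (le_lt_trans (av a aK)); lra.
  by rewrite zE; lra.
have lip2 : modC (f (z + a *: v) - f (z0 + a *: v)) <= c.
  apply: (le_trans lip); apply: le_trans dc; apply: ler_pM => //.
  - by rewrite divr_ge0 ?mulr_ge0 // ltW.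
  - exact: modV_ge0.
  - by rewrite lerDl.
  - exact: ltW.
have : modC (f (z0 + a *: v)) <= modC (f (z + a *: v))
    + modC (f (z + a *: v) - f (z0 + a *: v)).
  by rewrite -{1}[f (z0 + a *: v)](subKr (f (z + a *: v))) modCB.
lra.
Qed.

End VectorNorm.

(** * Volume of coordinate balls *)

Section LowerIntegral.
Local Open Scope ereal_scope.

(* No measurability of f and g: the integral of a nonnegative function is a
   supremum over the simple functions below it. *)
Lemma ge0_le_integral_nonmeas d (T : measurableType d) (R : realType)
    (mu : {measure set T -> \bar R}) (f g : T -> \bar R) :
  (forall x, 0 <= f x) -> (forall x, f x <= g x) ->
  \int[mu]_x f x <= \int[mu]_x g x.
Proof.
move=> f0 fg; have g0 x : 0 <= g x by exact: le_trans (fg x).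
rewrite !ge0_integralTE //; apply: le_ereal_sup => _ [h hf <-].
by exists h => // x; exact: le_trans (fg x).
Qed.

Lemma integral_ge_cst d (T : measurableType d) (R : realType)
    (mu : {measure set T -> \bar R}) (f : T -> \bar R) (A : set T) (c : R) :
  measurable A -> (0 <= c)%R -> (forall x, 0 <= f x) ->
  (forall x, A x -> c%:E <= f x) -> c%:E * mu A <= \int[mu]_x f x.
Proof.
move=> mA c0 f0 cf; rewrite -(integral_cst mu mA) integral_mkcond.
apply: ge0_le_integral_nonmeas => x; rewrite patchE.
  by case: ifP => //; rewrite lee_fin.
by case: ifPn => // /set_mem /cf.
Qed.

Variable R : realType.

Lemma lebesgue_int_ge0 m (f : 'rV[R]_m -> \bar R) :
  (forall v, 0 <= f v) -> 0 <= lebesgue_int f.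
Proof.
elim: m f => [|m IH] f f0 /=; first exact: f0.
by apply: integral_ge0 => x _; apply: IH.
Qed.

(** Induction on the dimension. The inner integral need not be a measurable function of the first
    coordinate, which [integral_ge_cst] does not require. *)
Lemma lebesgue_int_box m (f : 'rV[R]_m -> \bar R) (a : 'rV[R]_m) (e c : R) :
  (0 <= e)%R -> (0 <= c)%R -> (forall v, 0 <= f v) ->
  (forall v : 'rV[R]_m, (forall j, a ord0 j <= v ord0 j <= a ord0 j + e)%R -> c%:E <= f v) ->
  (c * e ^+ m)%:E <= lebesgue_int f.
Proof.
move=> e0 c0; elim: m f a => [|m IH] f a f0 fc /=.
  by rewrite expr0 mulr1; apply: fc; case.
have -> : (c * e ^+ m.+1)%:E = (c * e ^+ m)%:E *
    lebesgue_measure (`[a ord0 ord0, (a ord0 ord0 + e)%R] : set R).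
  rewrite lebesgue_measure_itv /= lte_fin ltrDl.
  case: ltP => [e_gt0|e_le0]; last first.
    have -> : e = 0%R by apply/le_anti; rewrite e_le0.
    by rewrite mule0 exprS mul0r mulr0.
  by rewrite -EFinD addrAC subrr add0r -EFinM -mulrA -exprSr.
apply: integral_ge_cst.
- exact: measurable_itv.
- by rewrite mulr_ge0 // exprn_ge0.
- by move=> x; apply: lebesgue_int_ge0.
move=> x /= ; rewrite in_itv /= => xa.
apply: (IH _ (\row_j a ord0 (lift ord0 j))) => [v|v vP]; first exact: f0.
have E0 (j : 'I_m.+1) : j = ord0 ->
    (row_mx (const_mx x : 'rV_1) v : 'rV[R]_m.+1) ord0 j = x.
  move=> ->; have -> : (ord0 : 'I_m.+1) = lshift m (ord0 : 'I_1) by exact: val_inj.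
  by etransitivity; [exact: row_mxEl|rewrite mxE].
have E1 (k : 'I_m) :
    (row_mx (const_mx x : 'rV_1) v : 'rV[R]_m.+1) ord0 (lift ord0 k) = v ord0 k.
  by rewrite -rshift1; exact: row_mxEr.
apply: fc => j; case: (unliftP ord0 j) => [k|] ->; last by rewrite E0.
by rewrite E1; have := vP k; rewrite mxE.
Qed.
End LowerIntegral.

Section PosDefDet.
Variable R : realType.
Local Notation C := (Cplx R).

(** In a unitary diagonalization the eigenvalues are the values of the form at the rows of P, which
    are nonzero because P is invertible. This makes the volume density strictly positive. *)
Lemma posdef_det_gt0 n (A : 'M[C]_n) : adjmx A = A ->
  (forall v : 'rV[C]_n, v != 0 -> 0 < (v *m A *m adjmx v) ord0 ord0) ->
  0 < \det A.
Proof.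
move=> Aherm Apos.
have /hermitian_normalmx /orthomx_spectralP AE : A \is hermsymmx.
  by apply/is_hermitianmxP; rewrite expr0 scale1r -[LHS]Aherm.
set P := spectralmx A in AE; set D := spectral_diag A in AE.
have Pu : P \in unitmx by exact: spectral_unit.
have PAP : P *m A *m adjmx P = diag_mx D.
  have -> : adjmx P = invmx P by rewrite invmx_unitary // spectral_unitarymx.
  by rewrite AE !mulmxA mulmxV // mul1mx -mulmxA mulmxV // mulmx1.
have D0 i : 0 < D ord0 i.
  have := Apos (row i P).
  have -> : (row i P *m A *m adjmx (row i P)) ord0 ord0 = D ord0 i.
    have := congr1 (fun B : 'M[C]_n => B i i) PAP.
    rewrite [in RHS]mxE eqxx mulr1n => <-.
    rewrite -row_mul !mxE; apply: eq_bigr => j _.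
    by rewrite !mxE.
  apply.
  apply/eqP => Pi0; have := row_free_unit P; rewrite Pu => /row_freeP[B PB].
  have := congr1 (row i) PB; rewrite row_mul Pi0 mul0mx => /rowP/(_ i).
  by rewrite !mxE eqxx => /eqP; rewrite eq_sym oner_eq0.
rewrite AE !det_mulmx mulrAC -det_mulmx mulVmx // det1 mul1r det_diag.
by apply: prodr_gt0 => i _.
Qed.
End PosDefDet.

Lemma det_continuous (R : realType) (T : topologicalType) n
    (F : T -> 'M[Cplx R]_n) (x : T) :
  (forall i j, {for x, continuous (fun t => F t i j)}) ->
  {for x, continuous (fun t => \det (F t))}.
Proof.
move=> cF.
have ceq (f g : T -> Cplx R) : f =1 g -> {for x, continuous g} -> {for x, continuous f}.
  by move=> /funext ->.
have cprod (s : 'I_n -> 'I_n) (r : seq 'I_n) :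
    {for x, continuous (fun t => \prod_(i <- r) F t i (s i))}.
  elim: r => [|i r IH].
    by apply: (ceq _ (cst 1)) => [t|]; [rewrite big_nil|exact: cst_continuous].
  apply: (ceq _ (fun t => F t i (s i) * \prod_(k <- r) F t k (s k))) => [t|].
    by rewrite big_cons.
  exact: (continuousM (cF i (s i)) IH).
have csum (I : Type) (r : seq I) (H : I -> T -> Cplx R) :
    (forall i, {for x, continuous (H i)}) ->
    {for x, continuous (fun t => \sum_(i <- r) H i t)}.
  move=> cH; elim: r => [|i r IH].
    by apply: (ceq _ (cst 0)) => [t|]; [rewrite big_nil|exact: cst_continuous].
  apply: (ceq _ (fun t => H i t + \sum_(k <- r) H k t)) => [t|].
    by rewrite big_cons.
  exact: (continuousD (cH i) IH).
apply: csum => s; apply: (@continuousM _ _ (cst _)); first exact: cst_continuous.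
exact: cprod.
Qed.

Section Volume.
Variables (R : realType) (n : nat) (X : ptopologicalType).
Variable M : complex_atlas R n X.
Local Notation C := (Cplx R).

Definition coord_ball (i : chart M) (z : 'rV[C]_n) (d : R) : set X :=
  cdom i `&` [set x | modV (coord i x - z) < d].

Lemma open_coord_ball i z d : open (coord_ball i z d).
Proof.
rewrite openE => x [ix xd]; apply: filterI.
  by apply: open_nbhs_nbhs; split => //; exact: cdom_open.
have H : nbhs (coord i x) [set w | modV (w - z) < d].
  apply/nbhsVP; exists (d - modV (coord i x - z)); first by rewrite subr_gt0.
  move=> w wx /=; rewrite -[w](subrK (coord i x)) -addrA.
  by apply: (le_lt_trans (modVD _ _)); rewrite -ltrBrDr.
exact: (coord_cont ix H).
Qed.

Lemma Ck_continuous (k m : nat) (D : set 'rV[R]_m) (f : 'rV[R]_m -> R) v :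
  is_Ck k D f -> D v -> {for v, continuous f}.
Proof. by case: k => [|k] [H _]; exact: H. Qed.

Definition rvec (z : 'rV[C]_n) : 'rV[R]_(n + n) :=
  row_mx (\row_j reC (z ord0 j)) (\row_j imC (z ord0 j)).

Lemma rvecK z : cvec (rvec z) = z.
Proof.
apply/rowP => j; rewrite mxE row_mxKl row_mxKr !mxE.
by case: (z ord0 j).
Qed.

Lemma cvec_reE v (z : 'rV[C]_n) j :
  reC ((cvec v - z) ord0 j) = v ord0 (lshift n j) - rvec z ord0 (lshift n j).
Proof. by rewrite /rvec row_mxEl !mxE reCD reCN. Qed.

Lemma cvec_imE v (z : 'rV[C]_n) j :
  imC ((cvec v - z) ord0 j) = v ord0 (rshift n j) - rvec z ord0 (rshift n j).
Proof. by rewrite /rvec row_mxEr !mxE imCD imCN. Qed.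

Variables (omega : hermitian_form M) (mu : {measure set (borel X) -> \bar R}).
Hypothesis mu_volume : is_volume omega mu.

Lemma ball_volume (i : chart M) (x0 : X) : cdom i x0 ->
  exists r c : R, [/\ 0 < r, 0 < c,
    forall z, modV (z - coord i x0) < r -> (coord i @` cdom i) z &
    forall z d, modV (z - coord i x0) < r / 2 -> 0 < d -> d <= r / 2 ->
      ((c * d ^+ (n + n))%:E <= mu (coord_ball i z d))%E].
Proof.
move=> ix0; set z0 := coord i x0.
pose G v := \det (gmat omega i (param i (cvec v))).
have imz0 : (coord i @` cdom i) z0 by exists x0.
have Gpos v : (coord i @` cdom i) (cvec v) -> 0 < reC (G v).
  move=> [x ix xv]; rewrite /G -xv coordK //.
  have := posdef_det_gt0 (gmat_herm omega ix) (gmat_posdef omega ix).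
  by rewrite (@ltcE R) => /andP[].
have cG : {for rvec z0, continuous (@reC R \o G)}.
  apply: (continuousCP_comp _).1; apply: det_continuous => j k.
  have Dz : (@cvec R n @^-1` (coord i @` cdom i)) (rvec z0) by rewrite /= rvecK.
  have [sre sim] := gmat_smooth omega i j k.
  have cre := Ck_continuous (sre 0%N) Dz.
  have cim := Ck_continuous (sim 0%N) Dz.
  apply/(@cvgCP _ _ (nbhs _)) => e e0.
  have e20 : 0 < e / 2 by rewrite divr_gt0.
  move/cvgrPdist_lt : cre => /(_ _ e20) cre; move/cvgrPdist_lt : cim => /(_ _ e20) cim.
  near=> v.
  apply: (le_lt_trans (modC_le_ReIm _)); rewrite reCD imCD reCN imCN.
  rewrite (splitr e) ltrD //; rewrite distrC; near: v; [exact: cre|exact: cim].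
have Gz0 : 0 < reC (G (rvec z0)) by apply: Gpos; rewrite rvecK.
set c0 := reC (G (rvec z0)) / 2.
have c00 : 0 < c0 by rewrite divr_gt0.
have /nbhs_ballP[e /= e0 eP] : \forall v \near rvec z0, c0 < reC (G v).
  apply: (cG [set y | c0 < y]); apply: open_nbhs_nbhs; split; first exact: open_gt.
  by rewrite /= /c0 ltr_pdivrMr // ltr_pMr // ltr1n.
have /nbhsVP[r1 r10 r1P] : nbhs z0 (coord i @` cdom i).
  by apply: open_nbhs_nbhs; split => //; exact: coord_open.
pose r := Num.min e r1.
have r0 : 0 < r by rewrite lt_min e0.
have re : r <= e by rewrite ge_min lexx.
have rr1 : r <= r1 by rewrite ge_min lexx orbT.
have Glow v : modV (cvec v - z0) < r -> c0 <= reC (G v).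
  move=> vr; apply/ltW/eP; split => // p j; rewrite ord1 -ball_normE /=.
  have /modV_ltP -/(_ r0) H := vr.
  rewrite distrC; apply: lt_le_trans re.
  have [k ->|k ->] := split_ordP j; apply: le_lt_trans (H k).
  - by rewrite -cvec_reE Re_le_modC.
  - by rewrite -cvec_imE Im_le_modC.
(* [c0] bounds the density below near z0. The box of side d / 4 with lowest corner z lies in the
   ball, the modulus of each complex coordinate being at most d / 4 + d / 4. *)
exists r, (c0 * (1 / 4) ^+ (n + n)); split => //.
- by rewrite mulr_gt0 // exprn_gt0 // divr_gt0.
- by move=> z zr; apply: r1P; exact: lt_le_trans rr1.
move=> z d zr d0 dr; set A := coord_ball i z d.
have mA : measurable (A : set (borel X)).
  by apply: sub_sigma_algebra; exact: open_coord_ball.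
have Ai : A `<=` cdom i by move=> x [].
rewrite (mu_volume mA Ai).
rewrite -mulrA -exprMn.
apply: (@lebesgue_int_box R _ _ (rvec z)).
- by rewrite mulr_ge0 // ?ltW // divr_ge0.
- exact: ltW.
- move=> v; rewrite lee_fin indicE; case: (boolP (_ \in _)) => [|_]; last by rewrite mulr0.
  by move=> /set_mem[x [ix _] xv]; rewrite mulr1 ltW // Gpos //; exists x.
move=> v vP; rewrite lee_fin.
have vz : modV (cvec v - z) < d.
  apply/modV_ltP => // j; apply: (le_lt_trans (modC_le_ReIm _)).
  have small k : `|v ord0 k - rvec z ord0 k| <= d / 4.
    by have /andP[v1 v2] := vP k; rewrite ger0_norm; lra.
  by rewrite cvec_reE cvec_imE; apply: (le_lt_trans (lerD (small _) (small _))); lra.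
have vz0 : modV (cvec v - z0) < r.
  rewrite -[cvec v](subrK z) -addrA; apply: (le_lt_trans (modVD _ _)); lra.
have [x ix xv] := r1P _ (lt_le_trans vz0 rr1).
rewrite indicE mem_set ?mulr1; first exact: Glow.
by exists x => //; split => //=; rewrite xv.
Unshelve. all: by end_near. Qed.
End Volume.

(** * Sections and singular metrics *)

(** By monotonicity each local property holds for all large constants, so compactness yields one
    constant that serves everywhere. *)
Lemma compact_uniform_bound (R : realType) (X : topologicalType)
    (P : R -> X -> Prop) : compact [set: X] ->
  (forall C C' x, C <= C' -> P C x -> P C' x) ->
  (forall x : X, exists C, \forall y \near x, P C y) ->
  exists2 C, 1 <= C & forall x, P C x.
Proof.
move=> /compact_near_coveringP cX mono loc.
have : \forall C \near +oo, [set: X] `<=` P C.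
  apply: cX => x _; have [C CP] := loc x.
  exists ((fun y => P C y) : set X, (fun D => C <= D) : set R) => /=.
    split; first exact: CP.
    exact: (nbhs_pinfty_ge (num_real C)).
  by move=> [y D] /= [PC CD]; exact: mono PC.
move=> /(pinfty_ex_ge (num_real 1))[C C1 CP].
by exists C => // x; exact: CP.
Qed.

Section SupremumBound.
Variables (R : realType) (n : nat) (X : ptopologicalType).
Variable M : complex_atlas R n X.
Local Notation C := (Cplx R).
Variables (L : line_bundle M) (mu : {measure set (borel X) -> \bar R}).
Variable h : singular_metric L mu.

Lemma triv_atP (x : X) : tdom (triv_at L x) x.
Proof. by rewrite /triv_at; case: cid. Qed.

Lemma trans_neq0 a b x : tdom a x -> tdom b x -> @trans _ _ _ _ L a b x != 0.
Proof.
move=> ax bx; have := trans_cocycle ax bx ax; rewrite (trans_id ax).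
by apply: contra_eq_neq => ->; rewrite mul0r eq_sym oner_neq0.
Qed.

Lemma herm_prodE p (s s' : triv L -> X -> C) a x :
  is_section p setT s -> is_section p setT s' -> tdom a x ->
  herm_prod h p s s' x = s a x * (s' a x)^* * toC (hnorm h a x ^+ (2 * p)%N).
Proof.
move=> [_ ss] [_ ss'] ax; rewrite /herm_prod; set b := triv_at L x.
have bx : tdom b x by exact: triv_atP.
rewrite (ss b a x) // (ss' b a x) // (hnorm_change h bx ax).
rewrite rmorphM /= rmorphXn /= exprMn toCM.
have -> : toC (modC (trans b a x) ^+ (2 * p)) = trans b a x ^+ p * (trans b a x)^* ^+ p.
  by rewrite exprM toCX toCX -normCE normCK exprMn.
ring.
Qed.

Lemma sqnormE p (s : triv L -> X -> C) a x : is_section p setT s -> tdom a x ->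
  sqnorm h p s x = modC (s a x) ^+ 2 * hnorm h a x ^+ (2 * p)%N.
Proof.
move=> ss ax; rewrite /sqnorm (herm_prodE ss ss ax) -normCK normCE -toCX -toCM.
by [].
Qed.

Lemma sqnorm_ge0 p (s : triv L -> X -> C) x : is_section p setT s ->
  0 <= sqnorm h p s x.
Proof.
move=> ss; rewrite (sqnormE ss (triv_atP x)) mulr_ge0 ?sqr_ge0 //.
by rewrite exprn_ge0 // ltW //; apply: hnorm_gt0; exact: triv_atP.
Qed.

Hypothesis h_bounded : locally_bounded_weights h.

(** A weight bounded by B in absolute value means that |e_a|_h lies between exp (- B) and exp B.
    With E = exp B, passing between |s|_h^2 and the squared modulus of a coefficient costs a factor
    E^(2 p), of the kind that may be lost. *)
Lemma metric_bounds a x0 : tdom a x0 -> exists2 E : R, 1 <= E &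
  \forall y \near x0, [/\ tdom a y, hnorm h a y <= E & 1 <= E * hnorm h a y].
Proof.
(* The frame e_a itself, by its coefficients: e_a = (trans b a) e_b. *)
move=> ax0; pose e (b : triv L) := trans b a.
have fe : is_frame (tdom a) e.
  split; last by move=> b x ax bx; exact: trans_neq0.
  split=> [b|b c x ax bx cx]; first by rewrite setIC; exact: trans_holo.
  by rewrite expr1 /e trans_cocycle.
have [B BP] := h_bounded (tdom_open a) fe ax0.
have B0 : 0 <= B by have := nbhs_singleton BP; exact: le_trans.
exists (expR B); first by rewrite -expR0 ler_expR.
have na : \forall y \near x0, tdom a y.
  by apply: open_nbhs_nbhs; split => //; exact: tdom_open.
apply: filterS2 BP na => y By ay.
have hy := hnorm_gt0 h ay.
have sE : sqnorm h 1 e y = hnorm h a y ^+ 2.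
  have by_ : tdom (triv_at L y) y by exact: triv_atP.
  rewrite /sqnorm /herm_prod /e -normCK normCE -toCX -toCM muln1.
  by rewrite (hnorm_change h by_ ay) exprMn.
move: By; rewrite /weight normrN sE sqrtr_sqr (gtr0_norm hy) => lnB.
split => //.
  by rewrite -{1}(lnK hy) ler_expR; move: lnB; rewrite ler_norml => /andP[].
rewrite -{1}(lnK hy) -expRD -expR0 ler_expR.
by move: lnB; rewrite ler_norml => /andP[]; lra.
Qed.

Lemma local_data x0 : exists (i : chart M) (a : triv L) (E r : R),
  [/\ cdom i x0, tdom a x0, 1 <= E, 0 < r &
   forall z, modV (z - coord i x0) < 2 * r ->
     [/\ cdom i (param i z), coord i (param i z) = z, tdom a (param i z),
         hnorm h a (param i z) <= E & 1 <= E * hnorm h a (param i z)]].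
Proof.
have [i ix0] := cdom_cover M x0; have [a ax0] := tdom_cover L x0.
have [E E1 EP] := metric_bounds ax0.
have /nbhsVP[r1 r10 r1P] : nbhs (coord i x0) (coord i @` cdom i).
  by apply: open_nbhs_nbhs; split; [exact: coord_open|exists x0].
have := param_cont ix0; rewrite /prop_for /continuous_at coordK // => cp.
have /nbhsVP[r2 r20 r2P] := cp _ EP.
exists i, a, E, (Num.min r1 r2 / 2); split => //.
  by rewrite divr_gt0 // lt_min r10.
move=> z; rewrite mulrC divfK // lt_min => /andP[/r1P[x ix xz] /r2P[]].
by rewrite -xz coordK // => ax xE Ex.
Qed.

Lemma param_section_diff p (s : triv L -> X -> C) a (i : chart M) z :
  is_section p setT s -> cdom i (param i z) -> coord i (param i z) = z ->
  tdom a (param i z) -> differentiable (s a \o param i) z.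
Proof.
move=> [hs _] iz zE az.
by have := hs a (param i z) (conj I az) i iz; rewrite zE.
Qed.

(** Only finiteness is at stake: the bound depends on s. It makes the supremum in [sup_le_integral]
    a real number, and gives [bergman_bounded]. *)
Lemma sqnorm_bounded p (s : triv L -> X -> C) : compact [set: X] ->
  is_section p setT s -> exists2 B : R, 1 <= B & forall x, sqnorm h p s x <= B.
Proof.
move=> cX ss; apply: (@compact_uniform_bound _ _ (fun B x => sqnorm h p s x <= B)) => //.
  by move=> B B' x BB /le_trans; apply.
move=> x0; have [i [a [E [r [ix0 ax0 E1 r0 H]]]]] := local_data x0.
have z0 : modV (coord i x0 - coord i x0) < 2 * r by rewrite subrr modV0 mulr_gt0.
have [c1 c2 c3 c4 c5] := H _ z0.
have du : differentiable (s a \o param i) (coord i x0).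
  exact: (param_section_diff ss c1 c2 c3).
have cu := differentiable_continuous du.
have N1 : nbhs (s a (param i (coord i x0))) [set w : C | modC (w - s a x0) < 1].
  by rewrite coordK //; apply/nbhsCP; exists 1.
have /nbhsVP[d d0 dP'] := cu _ N1.
have dP z : modV (z - coord i x0) < d -> modC (s a (param i z)) < modC (s a x0) + 1.
  move=> /dP' /= zx.
  rewrite -[s a (param i z)](subrK (s a x0)); apply: (le_lt_trans (modCD _ _)).
  by rewrite addrC ltrD2l.
exists ((modC (s a x0) + 1) ^+ 2 * E ^+ (2 * p)).
have : nbhs x0 (coord_ball i (coord i x0) (Num.min d (2 * r))).
  apply: open_nbhs_nbhs; split; first exact: open_coord_ball.
  by split => //=; rewrite subrr modV0 lt_min d0 mulr_gt0.
apply: filterS => y [iy /=]; rewrite lt_min => /andP[/dP yd /H].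
rewrite coordK // in yd * => -[_ _ ay hy _].
rewrite (sqnormE ss ay).
have h0 : 0 <= hnorm h a y by apply: ltW; exact: hnorm_gt0.
have E0 : 0 <= E by exact: le_trans E1.
have H1 : modC (s a y) ^+ 2 <= (modC (s a x0) + 1) ^+ 2.
  by rewrite lerXn2r ?nnegrE ?addr_ge0 ?modC_ge0 // ltW.
have H2 : hnorm h a y ^+ (2 * p) <= E ^+ (2 * p) by rewrite lerXn2r ?nnegrE.
by apply: ler_pM; rewrite ?exprn_ge0 ?modC_ge0.
Qed.

End SupremumBound.

(** * Local comparison of the supremum with the L^2 norm *)

Section SupByIntegral.
Variables (R : realType) (n : nat) (X : ptopologicalType).
Variable M : complex_atlas R n X.
Local Notation C := (Cplx R).
Variables (omega : hermitian_form M) (mu : {measure set (borel X) -> \bar R}).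
Hypothesis mu_volume : is_volume omega mu.
Variables (L : line_bundle M) (h : singular_metric L mu).
Hypothesis h_bounded : locally_bounded_weights h.

Lemma sqnorm_sandwich p (s : triv L -> X -> C) a x E : is_section p setT s ->
  tdom a x -> 1 <= E -> hnorm h a x <= E -> 1 <= E * hnorm h a x ->
  modC (s a x) ^+ 2 <= (E ^+ p) ^+ 2 * sqnorm h p s x /\
  sqnorm h p s x <= (E ^+ p) ^+ 2 * modC (s a x) ^+ 2.
Proof.
move=> ss ax E1 hE Eh; rewrite (sqnormE h ss ax) -exprM (mulnC p).
have h0 : 0 <= hnorm h a x by apply: ltW; exact: hnorm_gt0.
have E0 : 0 <= E by exact: le_trans E1.
split.
  by rewrite mulrCA -exprMn ler_peMr ?exprn_ge0 ?modC_ge0 // exprn_ege1.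
rewrite mulrC; apply: ler_wpM2r; first by rewrite exprn_ge0 ?modC_ge0.
by rewrite lerXn2r ?nnegrE.
Qed.

Lemma local_sup_le_integral (x0 : X) : exists D : R, \forall y \near x0,
  1 <= D /\ forall p (s : triv L -> X -> C) m, is_section p setT s -> 0 <= m ->
    (forall x, sqnorm h p s x <= m ^+ 2) -> m ^+ 2 <= 2 * sqnorm h p s y ->
    ((m ^+ 2)%:E <= (D ^+ p.+1)%:E * \int[mu]_x (sqnorm h p s x)%:E)%E.
Proof.
have [i [a [E [r1 [ix0 ax0 E1 r10 H]]]]] := local_data h_bounded x0.
have [r2 [c [r20 c0 _ vol]]] := ball_volume mu_volume ix0.
set z0 := coord i x0 in H vol.
pose r := Num.min r1 (r2 / 2).
have r0 : 0 < r by rewrite lt_min r10 divr_gt0.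
have rr1 : r <= r1 by rewrite ge_min lexx.
have rr2 : r <= r2 / 2 by rewrite ge_min lexx orbT.
have {}H z : modV (z - z0) < 2 * r -> [/\ cdom i (param i z),
    coord i (param i z) = z, tdom a (param i z),
    hnorm h a (param i z) <= E & 1 <= E * hnorm h a (param i z)].
  by move=> zr; apply: H; apply: lt_le_trans zr _; rewrite ler_pM2l.
have r160 : 0 < r / 16 / 16 by rewrite !divr_gt0.
pose q := c * (r / 16 / 16) ^+ (n + n) / 16.
have q0 : 0 < q.
  by apply: divr_gt0 => //; apply: mulr_gt0 => //; rewrite exprn_gt0.
have E0 : 0 < E by exact: lt_le_trans E1.
(* The integral turns out to be at least m^2 q / E^((4 + 4 n) p). In [D ^+ p.+1], p factors absorb
   the power of E and the last one absorbs q; the [+ 1] ensures D >= 1. *)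
pose D := (q^-1 + 1) * E ^+ (4 + 4 * n).
have EE1 : 1 <= E ^+ (4 + 4 * n) by rewrite exprn_ege1.
have D1 : 1 <= D.
  by rewrite /D mulr_ege1 // lerDr invr_ge0 ltW.
exists D.
have : nbhs x0 (coord_ball i z0 r).
  apply: open_nbhs_nbhs; split; first exact: open_coord_ball.
  by split => //=; rewrite subrr modV0.
apply: filterS => y [iy /= yr]; split => // p s m ss m0 sm my.
pose u : 'rV[C]_n -> C := s a \o param i.
have Ep0 : 0 < E ^+ p by rewrite exprn_gt0.
have Ep1 : 1 <= E ^+ p by rewrite exprn_ege1.
have Hu z : modV (z - z0) < 2 * r -> differentiable u z /\ modC (u z) <= m * E ^+ p.
  move=> /H[iz zE az hE Eh]; split; first exact: (param_section_diff ss iz zE az).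
  have [le1 _] := sqnorm_sandwich ss az E1 hE Eh.
  rewrite -(ler_pXn2r (n := 2)) ?nnegrE ?modC_ge0 // ?mulr_ge0 // ?(ltW Ep0) //.
  apply: (le_trans le1); rewrite exprMn mulrC.
  by apply: ler_wpM2r => //; rewrite exprn_ge0 // ltW.
(* The coefficient u is bounded by m E^p, and |u| >= m / (2 E^p) at y. On a ball of this radius
   [lipschitz_bound] lets u vary by at most m / (8 E^p), so |u| stays above m / (4 E^p). *)
pose d := r / 16 / 16 / (E ^+ p) ^+ 2.
have d0 : 0 < d by rewrite divr_gt0 // exprn_gt0.
have Ep21 : 1 <= (E ^+ p) ^+ 2 by rewrite exprn_ege1.
have dr : d <= r / 16 / 16.
  by rewrite /d ler_pdivrMr ?exprn_gt0 // ler_peMr // ltW.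
have y2r : modV (coord i y - z0) < 2 * r by apply: (lt_trans yr); lra.
have [_ _ ay hE Eh] := H _ y2r; rewrite coordK // in ay hE Eh.
have uyE : u (coord i y) = s a y by rewrite /u /= coordK.
have um : m <= 2 * E ^+ p * modC (s a y).
  rewrite -(ler_pXn2r (n := 2)) ?nnegrE ?mulr_ge0 ?modC_ge0 ?(ltW Ep0) //.
  have [_ le2] := sqnorm_sandwich ss ay E1 hE Eh.
  apply: (le_trans my); rewrite !exprMn -mulrA.
  have : 0 <= sqnorm h p s y by exact: sqnorm_ge0.
  by move: le2; set A := _ * _; rewrite /= => le2 s0; lra.
have low x : coord_ball i (coord i y) d x ->
    m ^+ 2 / (16 * (E ^+ p) ^+ 4) <= sqnorm h p s x.
  move=> [ix /= xy].
  have x2r : modV (coord i x - z0) < 2 * r.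
    rewrite -[coord i x](subrK (coord i y)) -addrA.
    by apply: (le_lt_trans (modVD _ _)); lra.
  have [_ _ ax hEx Ehx] := H _ x2r; rewrite coordK // in ax hEx Ehx.
  have xd8 : modV (coord i x - coord i y) <= r / 8 by lra.
  have := lipschitz_bound r0 Hu yr xd8.
  rewrite uyE {1}/u /= coordK // => lip.
  have lip2 : modC (s a x - s a y) <= m / (8 * E ^+ p).
    apply: (le_trans lip).
    have -> : m / (8 * E ^+ p) = 32 * (m * E ^+ p) / r * d.
      by rewrite /d; field; rewrite !gt_eqF.
    apply: ler_wpM2l; last exact: ltW.
    by rewrite divr_ge0 ?(ltW r0) // mulr_ge0 // mulr_ge0 // ltW.
  have m4 : m / (2 * E ^+ p) <= modC (s a y).
    by rewrite ler_pdivrMr ?mulr_gt0 // mulrC.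
  have tri : modC (s a y) <= modC (s a x) + modC (s a x - s a y).
    by rewrite -{1}[s a y](subKr (s a x)) modCB.
  have eqm : m / (2 * E ^+ p) = m / (8 * E ^+ p) + 3 * (m / (8 * E ^+ p)).
    by field; rewrite gt_eqF.
  have m8 : 0 <= m / (8 * E ^+ p) by rewrite divr_ge0 // mulr_ge0 // ltW.
  have mx : m / (4 * E ^+ p) <= modC (s a x).
    have -> : m / (4 * E ^+ p) = 2 * (m / (8 * E ^+ p)).
      by field; rewrite gt_eqF.
    lra.
  have [le1 _] := sqnorm_sandwich ss ax E1 hEx Ehx.
  have mx2 : (m / (4 * E ^+ p)) ^+ 2 <= modC (s a x) ^+ 2.
    by rewrite lerXn2r ?nnegrE ?modC_ge0 // divr_ge0 // mulr_ge0 // ltW.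
  have := le_trans mx2 le1; rewrite [leRHS]mulrC -ler_pdivrMr ?exprn_gt0 // => le3.
  apply: le_trans le3; rewrite le_eqVlt; apply/orP; left; apply/eqP.
  by field; rewrite gt_eqF.
have mball : measurable (coord_ball i (coord i y) d : set (borel X)).
  by apply: sub_sigma_algebra; exact: open_coord_ball.
have low0 : 0 <= m ^+ 2 / (16 * (E ^+ p) ^+ 4).
  by rewrite divr_ge0 ?sqr_ge0 // mulr_ge0 // exprn_ge0 // ltW.
have := @integral_ge_cst _ (borel X) R mu (fun x => (sqnorm h p s x)%:E) _ _
  mball low0.
move=> /(_ (fun x => sqnorm_ge0 h x ss)) /(_ low) int_low.
have yr2 : modV (coord i y - z0) < r2 / 2 by exact: lt_le_trans rr2.
have dr2 : d <= r2 / 2 by apply: le_trans rr2; lra.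
have {}int_low : ((m ^+ 2 / (16 * (E ^+ p) ^+ 4) * (c * d ^+ (n + n)))%:E
    <= \int[mu]_x (sqnorm h p s x)%:E)%E.
  apply: le_trans int_low; rewrite EFinM.
  by apply: lee_wpmul2l; [rewrite lee_fin|exact: vol].
have D0 : 0 <= D ^+ p.+1 by rewrite exprn_ge0 // (le_trans _ D1).
have {int_low} := lee_wpmul2l (D0 : (0%:E <= (D ^+ p.+1)%:E)%E) int_low.
apply: le_trans; rewrite -EFinM lee_fin.
have -> : m ^+ 2 / (16 * (E ^+ p) ^+ 4) * (c * d ^+ (n + n)) =
    m ^+ 2 * (q / (E ^+ (4 + 4 * n)) ^+ p).
  have -> : (E ^+ (4 + 4 * n)) ^+ p = (E ^+ p) ^+ 4 * ((E ^+ p) ^+ 2) ^+ (n + n).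
    rewrite -!exprM -exprD; congr (_ ^+ _).
    by rewrite mulnC mulnDr addnn -mul2n (mulnA 2 2 n).
  rewrite /d /q !expr_div_n !exprMn; field.
  by rewrite !expf_neq0 // ?pnatr_eq0 // gt_eqF.
rewrite mulrCA ler_peMr ?sqr_ge0 //.
have Dq : 1 <= D * q.
  have -> : D * q = (1 + q) * E ^+ (4 + 4 * n) by rewrite /D; field; rewrite gt_eqF.
  by rewrite mulr_ege1 // lerDl ltW.
have DE : (E ^+ (4 + 4 * n)) ^+ p <= D ^+ p.
  have EED : E ^+ (4 + 4 * n) <= D.
    by rewrite /D ler_peMl ?(le_trans ler01 EE1) // lerDr invr_ge0 ltW.
  by rewrite lerXn2r ?nnegrE ?(le_trans ler01 EE1) ?(le_trans ler01 D1).
have -> : D ^+ p.+1 * (q / (E ^+ (4 + 4 * n)) ^+ p) =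
    (D * q) * (D ^+ p / (E ^+ (4 + 4 * n)) ^+ p) by rewrite exprS; ring.
by rewrite mulr_ege1 // ler_pdivlMr ?mul1r // !exprn_gt0.
Qed.

End SupByIntegral.

(** * Decay near the hypersurface *)

Section DecayNearHypersurface.
Variables (R : realType) (n : nat) (X : ptopologicalType).
Variable M : complex_atlas R n X.
Local Notation C := (Cplx R).
Variables (omega : hermitian_form M) (mu : {measure set (borel X) -> \bar R}).
Hypothesis mu_volume : is_volume omega mu.
Variables (L : line_bundle M) (h : singular_metric L mu).
Hypothesis h_bounded : locally_bounded_weights h.

Lemma sup_le_integral : compact [set: X] -> exists2 D : R, 1 <= D &
  forall p (s : triv L -> X -> C), is_section p setT s -> exists m : R,
    [/\ 0 <= m, forall x, sqnorm h p s x <= m ^+ 2 &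
      ((m ^+ 2)%:E <= (D ^+ p.+1)%:E * \int[mu]_x (sqnorm h p s x)%:E)%E].
Proof.
move=> cX.
have [|D D1 DP] := compact_uniform_bound cX _
    (local_sup_le_integral mu_volume h_bounded).
  move=> D D' x DD [D1 HD]; split; first exact: le_trans DD.
  move=> p s m ss m0 sm my; apply: (le_trans (HD p s m ss m0 sm my)).
  apply: lee_wpmul2r; first by apply: integral_ge0 => y _; exact: sqnorm_ge0.
  by rewrite lee_fin lerXn2r ?nnegrE ?(le_trans ler01) // (le_trans D1).
exists D => // p s ss.
have [B B1 BP] := sqnorm_bounded h_bounded cX ss.
pose S := sup (range (sqnorm h p s)).
have ubS : has_ubound (range (sqnorm h p s)) by exists B => _ [x _ <-].
have S_ge x : sqnorm h p s x <= S by apply: ub_le_sup => //; exists x.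
have S0 : 0 <= S by apply: le_trans (S_ge point); exact: sqnorm_ge0.
exists (Num.sqrt S); rewrite sqr_sqrtr //; split; [exact: sqrtr_ge0|exact: S_ge|].
have int0 : (0 <= \int[mu]_x (sqnorm h p s x)%:E)%E.
  by apply: integral_ge0 => y _; exact: sqnorm_ge0.
(* A point where the squared norm exceeds S / 2 exists only if S > 0; for S = 0 the inequality is
   trivial. *)
move: S0; rewrite le_eqVlt => /orP[/eqP <-|S_gt0].
  by rewrite mule_ge0 // lee_fin exprn_ge0 // (le_trans _ D1).
have ne : range (sqnorm h p s) !=set0 by exists (sqnorm h p s point), point.
have S2 : S / 2 < sup (range (sqnorm h p s)).
  by rewrite -/S ltr_pdivrMr // ltr_pMr // ltr1n.
have [_ [y _ <-] yS] := sup_gt ne S2.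
have [_ HD] := DP y.
have := HD p s (Num.sqrt S) ss (sqrtr_ge0 _).
rewrite sqr_sqrtr ?(ltW S_gt0) //; apply; first exact: S_ge.
by rewrite mulrC -ler_pdivrMr // ltW.
Qed.

Lemma param_nbhs (i : chart M) (y : X) (A : set X) : cdom i y -> nbhs y A ->
  nbhs (coord i y) (param i @^-1` A).
Proof.
move=> iy Ay; have := param_cont iy; rewrite /prop_for /continuous_at coordK //.
exact.
Qed.

Lemma coord_ball_nbhs (i : chart M) (y : X) (d : R) : cdom i y -> 0 < d ->
  nbhs y (coord_ball i (coord i y) d).
Proof.
move=> iy d0; apply: open_nbhs_nbhs; split; first exact: open_coord_ball.
by split => //=; rewrite subrr modV0.
Qed.

Lemma holomorphic_param (V : set X) (f : X -> C) (i : chart M) z :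
  holomorphic_on M V f -> cdom i (param i z) -> coord i (param i z) = z ->
  V (param i z) -> differentiable (f \o param i) z.
Proof. by move=> hf iz zE Vz; have := hf _ Vz i iz; rewrite zE. Qed.

(** If g and g' differed at y, they would differ nearby by continuity, so f would vanish on a
    neighborhood of y (or k = 0, at once absurd), against the nonzero differential of f at y. *)
Lemma hypersurface_extension_unique (Sigma V W W' : set X) (f g g' : X -> C) k y :
  defining_function M Sigma V f -> V y -> Sigma y ->
  open W -> W y -> holomorphic_on M W g ->
  open W' -> W' y -> holomorphic_on M W' g' ->
  (forall x, W x -> W' x -> f x ^+ k * g x = f x ^+ k * g' x) -> g y = g' y.
Proof.
move=> [oV hf zf nf] Vy Sy oW Wy hg oW' Wy' hg' eqg.
apply/eqP; rewrite -subr_eq0; apply/negP => /negP gg.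
have [i iy] := cdom_cover M y.
have [v dv] := nf y Vy Sy i iy.
have iy' : cdom i (param i (coord i y)) by rewrite coordK.
have cy' : coord i (param i (coord i y)) = coord i y by rewrite coordK.
have dg : differentiable (g \o param i) (coord i y).
  by apply: holomorphic_param hg iy' cy' _; rewrite coordK.
have dg' : differentiable (g' \o param i) (coord i y).
  by apply: holomorphic_param hg' iy' cy' _; rewrite coordK.
have df : differentiable (f \o param i) (coord i y).
  by apply: holomorphic_param hf iy' cy' _; rewrite coordK.
have cgg := continuousB (differentiable_continuous dg) (differentiable_continuous dg').
have N1 : nbhs (((g \o param i) - (g' \o param i)) (coord i y)) [set w : C | w != 0].
  apply/nbhsCP; exists (modC (g y - g' y)); first by rewrite modC_gt0.
  move=> w /=; rewrite [_ (coord i y)]/(g (param i (coord i y)) - _) /= coordK //.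
  by apply: contraTneq => ->; rewrite sub0r modCN ltxx.
have near_f : \forall z \near coord i y, (f \o param i) z = 0.
  have nW := param_nbhs iy (open_nbhs_nbhs (conj oW Wy)).
  have nW' := param_nbhs iy (open_nbhs_nbhs (conj oW' Wy')).
  apply: (@filterS3 _ _ (nbhs_filter (coord i y)) _ _ _ _ _ (cgg _ N1) nW nW')
    => z /= ggz Wz Wz'.
  have /eqP := eqg _ Wz Wz'; rewrite -subr_eq0 -mulrBr mulf_eq0 expf_eq0.
  by move=> /orP[/andP[_ /eqP]//|]; rewrite (negbTE ggz).
have : 'D_v (f \o param i) (coord i y) = 0.
  by rewrite (near_eq_derive (g := cst 0) v near_f) derive_cst.
by rewrite deriveE // => /eqP; rewrite (negbTE dv).
Qed.

(** Each point of Sigma comes with its own local quotient. Uniqueness of the values on Sigma makes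
    all of them restrictions of one function w. *)
Lemma divide_by_equation (Sigma V : set X) (f : X -> C) p k
    (s : triv L -> X -> C) (a : triv L) :
  defining_function M Sigma V f -> is_section p setT s ->
  vanishes_to_order Sigma k s ->
  exists w : X -> C,
    (forall x, V x -> tdom a x -> s a x = f x ^+ k * w x) /\
    forall (i : chart M) z v, cdom i (param i z) -> coord i (param i z) = z ->
      V (param i z) -> tdom a (param i z) -> derivable (w \o param i) z v.
Proof.
move=> Df ss van; have [oV hf zf _] := Df.
have /choice[g gP] : forall x, exists Wg : set X * (X -> C),
    Sigma x -> V x -> tdom a x -> [/\ open Wg.1, Wg.1 x, Wg.1 `<=` V `&` tdom a,
      holomorphic_on M Wg.1 Wg.2 & forall y, Wg.1 y -> s a y = f y ^+ k * Wg.2 y].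
  move=> x; have [[Sx Vx ax]|nx] := pselect [/\ Sigma x, V x & tdom a x].
    by have [W [g H]] := van x a V f Sx ax Vx Df; exists (W, g).
  by exists (set0, fun=> 0) => Sx Vx ax; exfalso; apply: nx.
(* At a point of Sigma, w takes the value there of the quotient chosen for that very point. *)
pose w x := if f x == 0 then (g x).2 x else s a x / f x ^+ k.
exists w; split=> [x Vx ax|i z v iz zE Vz az].
  rewrite /w; case: eqP => [/(zf x Vx) Sx|/eqP fx].
    by have [_ Wx _ _] := gP x Sx Vx ax; apply.
  by rewrite mulrC divfK // expf_neq0.
have nV := param_nbhs iz (open_nbhs_nbhs (conj oV Vz)); rewrite zE in nV.
have df : differentiable (f \o param i) z by exact: holomorphic_param hf iz zE Vz.
have [fz|fz] := eqVneq (f (param i z)) 0; last first.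
  have nf : nbhs ((f \o param i) z) [set c : C | c != 0].
    apply/nbhsCP; exists (modC (f (param i z))); first by rewrite modC_gt0.
    by move=> c /=; apply: contraTneq => ->; rewrite sub0r modCN ltxx.
  have nf' := differentiable_continuous df nf.
  have nE : {near z, (fun t => s a (param i t) / (f (param i t)) ^+ k) =1
      (w \o param i)}.
    by apply: (@filterS _ _ (nbhs_filter z) _ _ _ nf') => t /= /negbTE ft; rewrite /w ft.
  apply: near_eq_derivable nE _.
  have ds : derivable (s a \o param i) z v.
    apply: diff_derivable; exact: (param_section_diff ss iz zE az).
  have dfk : derivable (fun t => f (param i t) ^+ k) z v.
    have -> : (fun t => f (param i t) ^+ k) = (f \o param i) ^+ k.
      by rewrite exprfctE.
    by apply: derivableX; exact: diff_derivable.
  have fk : f (param i z) ^+ k != 0 by rewrite expf_neq0.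
  have dV := @derivableV _ _ (fun t => f (param i t) ^+ k) z v fk dfk.
  exact: (@derivableM _ _ (s a \o param i) _ z v ds dV).
have Sz := (zf _ Vz).2 fz.
have [oW Wz WV hg sE] := gP _ Sz Vz az; set W := (g (param i z)).1 in oW Wz WV hg sE.
have nW := param_nbhs iz (open_nbhs_nbhs (conj oW Wz)); rewrite zE in nW.
(* Near a point of Sigma the quotient chosen there is w: off Sigma by division, and at another point
   of Sigma because it agrees there with the quotient chosen for that point. *)
have nE : {near z, ((g (param i z)).2 \o param i) =1 (w \o param i)}.
  apply: (@filterS _ _ (nbhs_filter z) _ _ _ nW) => t /= Wt; have [Vt at_] := WV _ Wt.
  rewrite /w; case: eqP => [ft|/eqP ft]; last first.
    by rewrite sE // mulrC mulKf // expf_neq0.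
  have St := (zf _ Vt).2 ft.
  have [oW' Wt' _ hg' sE'] := gP _ St Vt at_.
  apply: (hypersurface_extension_unique Df Vt St oW Wt hg oW' Wt' hg').
  by move=> x Wx Wx'; exact: etrans (esym (sE x Wx)) (sE' x Wx').
apply: near_eq_derivable nE _; apply: diff_derivable.
exact: holomorphic_param hg iz zE Wz.
Qed.

End DecayNearHypersurface.

Section Decay.
Variables (R : realType) (n : nat) (X : ptopologicalType).
Variable M : complex_atlas R n X.
Local Notation C := (Cplx R).
Variables (mu : {measure set (borel X) -> \bar R}).
Variables (L : line_bundle M) (h : singular_metric L mu).
Hypothesis h_bounded : locally_bounded_weights h.
Variable Sigma : set X.
Hypothesis Sigma_smooth : smooth_hypersurface M Sigma.

(** The order of the quantifiers matters: K comes before e, so e can be taken small enough to beat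
    K, and only the neighborhood shrinks with e. The order k is independent of p here. *)
Lemma decay_near_hypersurface (x0 : X) : Sigma x0 ->
  exists2 K : R, 1 <= K & forall e : R, 0 < e -> \forall y \near x0,
    forall p k (s : triv L -> X -> C) m, is_section p setT s ->
      vanishes_to_order Sigma k s -> 0 <= m ->
      (forall x, sqnorm h p s x <= m ^+ 2) ->
      sqnorm h p s y <= K ^+ p.+1 * (e ^+ k) ^+ 2 * m ^+ 2.
Proof.
move=> Sx0; have [_ /(_ x0 Sx0)[V [f [Vx0 Df]]]] := Sigma_smooth.
have [oV hf zf nf] := Df.
have [i [a [E [r1 [ix0 ax0 E1 r10 H]]]]] := local_data h_bounded x0.
set z0 := coord i x0 in H.
have iz0 : cdom i (param i z0) by rewrite /z0 coordK.
have z0E : coord i (param i z0) = z0 by rewrite /z0 coordK.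
have Vz0 : V (param i z0) by rewrite /z0 coordK.
pose phi : 'rV[C]_n -> C := f \o param i.
have phi0 : phi z0 = 0 by rewrite /phi /= /z0 coordK //; apply/(zf x0 Vx0).
have [v dv] := nf x0 Vx0 Sx0 i ix0.
have dphi0 : differentiable phi z0 by exact: holomorphic_param hf iz0 z0E Vz0.
have phi_small (e : R) : 0 < e -> exists2 d : R, 0 < d &
    forall z, modV (z - z0) < d -> modC (phi z) < e.
  move=> e0; have N1 : nbhs (phi z0) [set w : C | modC w < e].
    by rewrite phi0; apply/nbhsCP; exists e => // w; rewrite subr0.
  have /nbhsVP[d d0 dP] := differentiable_continuous dphi0 N1.
  by exists d => // z /dP.
have /nbhsVP[r2 r20 r2P] := param_nbhs ix0 (open_nbhs_nbhs (conj oV Vx0)).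
have [r3 r30 r3P] := phi_small 1 ltr01.
pose r := Num.min r1 (Num.min r2 r3 / 2).
have r23 : 0 < Num.min r2 r3 by rewrite lt_min r20.
have r0 : 0 < r by rewrite lt_min r10 divr_gt0.
have {r10}H' z : modV (z - z0) < 2 * r ->
    [/\ V (param i z), modC (phi z) <= 1 & modV (z - z0) < 2 * r1].
  move=> zr.
  have zr1 : modV (z - z0) < 2 * r1.
    by apply: (lt_le_trans zr); rewrite ler_pM2l // ge_min lexx.
  have : modV (z - z0) < Num.min r2 r3.
    apply: (lt_le_trans zr); rewrite mulrC -ler_pdivlMr //.
    by rewrite ge_min lexx orbT.
  by rewrite lt_min => /andP[/r2P Vz /r3P/ltW].
have Hphi z : modV (z - z0) < 2 * r -> differentiable phi z /\ modC (phi z) <= 1.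
  move=> /H'[Vz p1 /H[iz zE _ _ _]]; split; last exact: p1.
  exact: holomorphic_param hf iz zE Vz.
have [rho [K0 [c [d [rho0 rhoK c0 d0 Hd]]]]] :=
  transverse_square r0 Hphi phi0 dv.
have K00 : 0 < K0 by exact: lt_trans rhoK.
have E0 : 0 < E by exact: lt_le_trans E1.
(* The estimate |s_a(y)| <= 2 m E^p e^k is squared, and returning to |s|_h^2 costs another E^(2 p):
   in all 4 E^(4 p). *)
exists (4 * E ^+ 4) => [|e e0]; first by rewrite mulr_ege1 ?exprn_ege1 // ler1n.
(* The ratio |f(y)| / c is then below e. *)
have [d' d'0 d'P] := phi_small (c * e) (mulr_gt0 c0 e0).
have dd0 : 0 < Num.min d d' by rewrite lt_min d0.
apply: filterS (coord_ball_nbhs ix0 dd0).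
move=> y [iy /=]; rewrite lt_min => /andP[yd yd'] p k s m ss van m0 sm.
have [H1 H2] := Hd _ yd.
have [w [sw dw]] := divide_by_equation a Df ss van.
have Ep0 : 0 < E ^+ p by rewrite exprn_gt0.
have good b : modC b <= 2 * K0 -> let z := coord i y + b *: v in
    [/\ V (param i z), cdom i (param i z), coord i (param i z) = z,
     tdom a (param i z) & modC (s a (param i z)) <= m * E ^+ p].
  move=> /H1/H'[Vz _ /H[iz zE az hE Eh]] /=; split => //.
  have [le1 _] := sqnorm_sandwich ss az E1 hE Eh.
  rewrite -(ler_pXn2r (n := 2)) ?nnegrE ?modC_ge0 // ?mulr_ge0 // ?(ltW Ep0) //.
  apply: (le_trans le1); rewrite exprMn mulrC.
  by apply: ler_wpM2r => //; rewrite exprn_ge0 // ltW.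
have ub : modC (s a y) <= 2 * (m * E ^+ p) * (modC (f y) / c) ^+ k.
  have := @vanishing_bound R n (s a \o param i) phi (w \o param i) (coord i y) v
    rho K0 c (m * E ^+ p) k rho0 rhoK c0.
  rewrite /phi /= coordK //; apply.
  - by move=> b /good[Vz iz zE az _]; exact: dw.
  - by move=> b /good[Vz iz zE az _]; exact: sw.
  - move=> b sb; split; first exact: H2.
    have [|//] := good b.
    case: b sb => x1 x2 [/= b1 b2 _].
    by apply: Complex_small; apply: ltW; apply: le_lt_trans rhoK.
have ey : modC (f y) / c <= e.
  by rewrite ler_pdivrMr // mulrC; have := d'P _ yd'; rewrite /phi /= coordK // => /ltW.
have fc0 : 0 <= modC (f y) / c by rewrite divr_ge0 ?modC_ge0 // ltW.
have ub2 : modC (s a y) <= 2 * (m * E ^+ p) * e ^+ k.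
  apply: (le_trans ub); apply: ler_wpM2l.
    by rewrite mulr_ge0 // mulr_ge0 // ltW.
  by rewrite lerXn2r ?nnegrE // ltW.
have y2r : modV (coord i y - z0) < 2 * r.
  have := H1 0; rewrite modC0 scale0r addr0; apply.
  by rewrite mulr_ge0 // ltW.
have [_ _ /H] := H' _ y2r.
case; rewrite coordK // => _ _ ay hE Eh.
have [_ le2] := sqnorm_sandwich ss ay E1 hE Eh.
apply: (le_trans le2).
have ub3 : modC (s a y) ^+ 2 <= (2 * (m * E ^+ p) * e ^+ k) ^+ 2.
  by rewrite lerXn2r ?nnegrE ?modC_ge0 // (le_trans _ ub2) ?modC_ge0.
apply: (@le_trans _ _ ((E ^+ p) ^+ 2 * (2 * (m * E ^+ p) * e ^+ k) ^+ 2)).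
  by rewrite ler_wpM2l // exprn_ge0 // ltW.
have -> : (E ^+ p) ^+ 2 * (2 * (m * E ^+ p) * e ^+ k) ^+ 2 =
  4 * (E ^+ 4) ^+ p * (e ^+ k) ^+ 2 * m ^+ 2.
  have -> : (E ^+ 4) ^+ p = (E ^+ p) ^+ 4 by rewrite -!exprM mulnC.
  by ring.
apply: ler_wpM2r; first exact: sqr_ge0.
apply: ler_wpM2r; first exact: sqr_ge0.
have E41 : 1 <= E ^+ 4 by rewrite exprn_ege1.
have E40 : 0 <= E ^+ 4 by exact: le_trans E41.
rewrite [(4 * E ^+ 4) ^+ p.+1]exprS; apply: ler_pM => //; first by rewrite exprn_ge0.
  by rewrite ler_peMr.
have E44 : E ^+ 4 <= 4 * E ^+ 4 by rewrite ler_peMl // ler1n.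
by rewrite lerXn2r ?nnegrE // mulr_ge0.
Qed.
End Decay.

(** * Partial Bergman kernels *)

Section ConullIntegral.
Context d (T : measurableType d) (R : realType) (mu : {measure set T -> \bar R}).
Variable D : set T.
Hypotheses (mD : measurable D) (D0 : mu (~` D) = 0%E).
Local Open Scope ereal_scope.
Import HBNNSimple.

(** The function f may be nonmeasurable, but the simple functions below it are measurable: the null
    set is discarded for each of them, and the supremum is taken afterwards. *)
Lemma ge0_integral_conull (f : T -> \bar R) : (forall x, 0 <= f x) ->
  \int[mu]_x f x = \int[mu]_(x in D) f x.
Proof.
move=> f0; apply/eqP; rewrite eq_le; apply/andP; split; last first.
  rewrite integral_mkcond; apply: ge0_le_integral_nonmeas => x; rewrite patchE;
    by case: ifP.
rewrite {1}ge0_integralTE //; apply: ge_ereal_sup => _ [k kf <-].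
rewrite -integralT_nnsfun.
rewrite (ge0_negligible_integral (measurableC mD) measurableT _ _ D0); first last.
- by move=> x _; rewrite lee_fin.
- exact/measurable_EFinP.
rewrite setTD setCK integral_mkcond [leRHS]integral_mkcond.
apply: ge0_le_integral_nonmeas => x; rewrite !patchE; case: ifP => // _;
  solve [exact: kf|by rewrite lee_fin].
Qed.

(* The integrand may fail to be measurable off D. *)
Lemma integral_conull (f : T -> \bar R) : \int[mu]_x f x = \int[mu]_(x in D) f x.
Proof.
rewrite integralE [RHS]integralE.
rewrite (ge0_integral_conull (f := (f ^\+)%E)); last by move=> x; exact: funepos_ge0.
by rewrite (ge0_integral_conull (f := (f ^\-)%E)) // => x; exact: funeneg_ge0.
Qed.

End ConullIntegral.

Section MetricMeasurability.
Variables (R : realType) (n : nat) (X : ptopologicalType).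
Variable M : complex_atlas R n X.
Local Notation C := (Cplx R).
Variables (L : line_bundle M) (mu : {measure set (borel X) -> \bar R}).
Variable h : singular_metric L mu.

Lemma continuous_on_open_measurable (U : set X) (g : X -> R) : open U ->
  (forall x, U x -> {for x, continuous g}) ->
  measurable_fun (U : set (borel X)) (g : borel X -> R).
Proof.
move=> oU cg; apply: (measurability _ (RGenOpens.measurableE R)).
move=> _ [_ [a [b ->]] <-]; apply: sub_sigma_algebra.
rewrite openE => x [Ux gx]; apply: filterI.
  exact: open_nbhs_nbhs.
by apply: (cg x Ux); apply: open_nbhs_nbhs; split.
Qed.

Lemma section_continuous p (s : triv L -> X -> C) a x : is_section p setT s ->
  tdom a x -> {for x, continuous (s a)}.
Proof.
move=> ss ax; have [i ix] := cdom_cover M x.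
have zE : coord i (param i (coord i x)) = coord i x by rewrite coordK.
have ix' : cdom i (param i (coord i x)) by rewrite coordK.
have ax' : tdom a (param i (coord i x)) by rewrite coordK.
have := differentiable_continuous (param_section_diff ss ix' zE ax').
move=> cs; rewrite /prop_for /continuous_at => A.
rewrite -{1}(coordK ix) => /cs /(coord_cont ix) nA.
have ni : nbhs x (cdom i) by apply: open_nbhs_nbhs; split => //; exact: cdom_open.
by apply: filterS2 ni nA => y iy /=; rewrite coordK.
Qed.

(** [hnorm_meas] has an exceptional null set for each trivialization; countably many trivializations
    keep their union null. *)
Lemma countable_trivializations : compact [set: X] ->
  exists a : nat -> triv L, forall x, exists k, tdom (a k) x.
Proof.
rewrite compact_cover => /(_ X setT (fun x => tdom (triv_at L x))).
case=> [x _|x _|D' _ cov]; first exact: tdom_open.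
  by exists x => //; exact: triv_atP.
exists (fun k => triv_at L (nth point (finmap.enum_fset D') k)) => x.
have [y yD xy] := cov x I.
by exists (index y (finmap.enum_fset D')); rewrite nth_index.
Qed.

Lemma reC_mul_conj (z w : C) : reC (z * w^*) = reC z * reC w + imC z * imC w.
Proof. by case: z w => [a b] [c d]; rewrite /= mulrN opprK. Qed.

Lemma imC_mul_conj (z w : C) : imC (z * w^*) = imC z * reC w - reC z * imC w.
Proof. by case: z w => [a b] [c d]; rewrite /= mulrN addrC. Qed.

(** Off the union of the null sets, each norm [hnorm h (t k)] is a Borel function, and Hermitian
    products are measurable on each of the countably many domains. The set D is the same for all p
    and all sections. *)
Lemma conull_measurable_metric : compact [set: X] ->
  exists D : set (borel X), [/\ measurable D, mu (~` D) = 0%E &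
    forall p s s', is_section (L := L) p setT s -> is_section p setT s' ->
      measurable_fun D (fun x : borel X => reC (herm_prod h p s s' x)) /\
      measurable_fun D (fun x : borel X => imC (herm_prod h p s s' x))].
Proof.
move=> cX; have [t tP] := countable_trivializations cX.
have /choice[f fP] := fun a => hnorm_meas h a.
have /choice[N NP] : forall k, exists N : set (borel X),
    [/\ measurable N, mu N = 0%E &
      forall x, ~ N x -> tdom (t k) x -> hnorm h (t k) x = f (t k) x].
  move=> k; have [_ [N [mN N0 NS]]] := fP (t k); exists N; split => // x Nx.
  by apply: contrapT => nE; apply: Nx; apply: NS.
pose D : set (borel X) := ~` \bigcup_k N k.
have mU : measurable (\bigcup_k N k).
  by apply: bigcupT_measurable => k; have [] := NP k.
have mD : measurable D by exact: measurableC.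
exists D; split => //.
  rewrite /D setCK; apply/negligibleP => //; apply: negligible_bigcup => k.
  by have [mN N0 _] := NP k; apply/negligibleP.
move=> p s s' ss ss'.
have mta k : measurable (tdom (t k) : set (borel X)).
  by apply: sub_sigma_algebra; exact: tdom_open.
have mre q (u : triv L -> X -> C) k : is_section q setT u ->
    measurable_fun (tdom (t k) : set (borel X)) (fun x : borel X => reC (u (t k) x)).
  move=> us; apply: continuous_on_open_measurable; first exact: tdom_open.
  by move=> x ax; have [] := continuousCP_comp (section_continuous us ax).
have mim q (u : triv L -> X -> C) k : is_section q setT u ->
    measurable_fun (tdom (t k) : set (borel X)) (fun x : borel X => imC (u (t k) x)).
  move=> us; apply: continuous_on_open_measurable; first exact: tdom_open.
  by move=> x ax; have [] := continuousCP_comp (section_continuous us ax).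
have pieces (H : C -> R) (H' : nat -> X -> R) :
    (forall k, measurable_fun (tdom (t k) : set (borel X)) (H' k : borel X -> R)) ->
    (forall k x, D x -> tdom (t k) x ->
      H (herm_prod h p s s' x) = H' k x * f (t k) x ^+ (2 * p)) ->
    measurable_fun D (fun x : borel X => H (herm_prod h p s s' x)).
  move=> mH HE _ Y mY.
  have -> : D `&` (fun x : borel X => H (herm_prod h p s s' x)) @^-1` Y =
    \bigcup_k (D `&` ((tdom (t k) : set (borel X)) `&`
      (fun x : borel X => H' k x * f (t k) x ^+ (2 * p)) @^-1` Y)).
    apply/seteqP; split => [x [Dx Yx]|x [k _ [Dx [kx Yx]]]].
      have [k kx] := tP x; exists k => //; split => //; split => //=.
      by rewrite -HE.
    by split => //=; rewrite (HE k).
  apply: bigcupT_measurable => k; apply: measurableI => //.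
  have mf : measurable_fun (tdom (t k) : set (borel X))
      (fun x : borel X => H' k x * f (t k) x ^+ (2 * p)).
    apply: measurable_funM; first exact: mH.
    apply: measurable_funX; apply: measurable_funS (fP (t k)).1 => //.
  exact: mf.
have hE k x : D x -> tdom (t k) x -> hnorm h (t k) x = f (t k) x.
  by move=> Dx; have [_ _] := NP k; apply => Nx; apply: Dx; exists k.
split.
- apply: (pieces (@reC R) (fun k x =>
    reC (s (t k) x) * reC (s' (t k) x) + imC (s (t k) x) * imC (s' (t k) x))).
    move=> k; apply: measurable_funD; apply: measurable_funM;
      solve [exact: mre ss|exact: mre ss'|exact: mim ss|exact: mim ss'].
  move=> k x Dx kx; rewrite (herm_prodE h ss ss' kx) (hE k x Dx kx).
  by rewrite reCM /= mulr0 subr0 reC_mul_conj.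
- apply: (pieces (@imC R) (fun k x =>
    imC (s (t k) x) * reC (s' (t k) x) - reC (s (t k) x) * imC (s' (t k) x))).
    move=> k; apply: measurable_funB; apply: measurable_funM;
      solve [exact: mre ss|exact: mre ss'|exact: mim ss|exact: mim ss'].
  move=> k x Dx kx; rewrite (herm_prodE h ss ss' kx) (hE k x Dx kx).
  by rewrite imCM /= mulr0 add0r imC_mul_conj.
Qed.

End MetricMeasurability.

Section BergmanKernel.
Variables (R : realType) (n : nat) (X : ptopologicalType).
Variable M : complex_atlas R n X.
Local Notation C := (Cplx R).
Variables (L : line_bundle M) (mu : {measure set (borel X) -> \bar R}).
Variable h : singular_metric L mu.
Variables (Sigma : set X) (t : R).

Lemma holomorphic_lin (V : set X) (c : C) (f g : X -> C) :
  holomorphic_on M V f -> holomorphic_on M V g ->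
  holomorphic_on M V (fun x => c * f x + g x).
Proof.
move=> hf hg x Vx i ix.
exact: (differentiableD (differentiableZ c (hf x Vx i ix)) (hg x Vx i ix)).
Qed.

Lemma holomorphic_sub (V W : set X) (f : X -> C) : V `<=` W ->
  holomorphic_on M W f -> holomorphic_on M V f.
Proof. by move=> VW hf x Vx; exact/hf/VW. Qed.

Lemma holomorphic0 (V : set X) : holomorphic_on M V (fun=> 0).
Proof. by move=> x Vx i ix; exact: differentiable_cst. Qed.

Lemma H00_0 p : in_H00 (L := L) Sigma t p (fun _ _ => 0).
Proof.
split; first split.
- by move=> a; exact: holomorphic0.
- by move=> a b x _ _ _; rewrite mulr0.
move=> x a V f Sx ax Vx [oV _ _ _]; exists (V `&` tdom a), (fun=> 0); split.
- by apply: openI => //; exact: tdom_open.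
- by [].
- by [].
- exact: holomorphic0.
- by move=> y _; rewrite mulr0.
Qed.

Lemma H00_lin p c (s s' : triv L -> X -> C) :
  in_H00 Sigma t p s -> in_H00 Sigma t p s' ->
  in_H00 Sigma t p (fun a x => c * s a x + s' a x).
Proof.
move=> [[hs ts] vs] [[hs' ts'] vs']; split; first split.
- by move=> a; exact: holomorphic_lin.
- move=> a b x Vx ax bx; rewrite (ts a b) // (ts' a b) //; ring.
move=> x a V f Sx ax Vx Df.
have [W [g [oW Wx WV hg sE]]] := vs x a V f Sx ax Vx Df.
have [W' [g' [oW' Wx' WV' hg' sE']]] := vs' x a V f Sx ax Vx Df.
exists (W `&` W'), (fun y => c * g y + g' y); split.
- exact: openI.
- by [].
- by move=> y [/WV].
- by apply: holomorphic_lin; [apply: holomorphic_sub hg|apply: holomorphic_sub hg'];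
    [exact: subIsetl|exact: subIsetr].
- move=> y [Wy Wy']; rewrite (sE y Wy) (sE' y Wy'); ring.
Qed.

Definition combination d (c : 'I_d -> C) (S : 'I_d -> triv L -> X -> C) a x : C :=
  \sum_j c j * S j a x.

Lemma H00_combination p d (c : 'I_d -> C) (S : 'I_d -> triv L -> X -> C) :
  (forall j, in_H00 Sigma t p (S j)) -> in_H00 Sigma t p (combination c S).
Proof.
move=> HS; rewrite /combination.
elim: (index_enum _) => [|j r IH].
  rewrite (_ : (fun a x => _) = (fun _ _ => 0)); first exact: H00_0.
  by apply/funext => a; apply/funext => x; rewrite big_nil.
rewrite (_ : (fun a x => _) =
  (fun a x => c j * S j a x + \sum_(i <- r) c i * S i a x)); first exact: H00_lin.
by apply/funext => a; apply/funext => x; rewrite big_cons.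
Qed.

Lemma reC_sum (I : Type) (r : seq I) (F : I -> C) :
  reC (\sum_(i <- r) F i) = \sum_(i <- r) reC (F i).
Proof. by elim: r => [|i r IH]; rewrite ?big_nil // !big_cons reCD IH. Qed.

Lemma herm_prod_combination p d (c : 'I_d -> C) (S : 'I_d -> triv L -> X -> C) x :
  herm_prod h p (combination c S) (combination c S) x =
  \sum_j \sum_k c j * (c k)^* * herm_prod h p (S j) (S k) x.
Proof.
rewrite /herm_prod /combination rmorph_sum /= mulr_suml mulr_suml.
apply: eq_bigr => j _; rewrite mulr_sumr mulr_suml.
by apply: eq_bigr => k _; rewrite rmorphM /=; ring.
Qed.

(** Domination, not sharpness: it transfers integrability from the squared norms to the mixed
    products. *)
Lemma herm_prod_le p (s s' : triv L -> X -> C) x :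
  is_section p setT s -> is_section p setT s' ->
  modC (herm_prod h p s s' x) <= sqnorm h p s x + sqnorm h p s' x.
Proof.
move=> ss ss'; have ax := triv_atP L x.
rewrite (herm_prodE h ss ss' ax) (sqnormE h ss ax) (sqnormE h ss' ax).
have h0 : 0 <= hnorm h (triv_at L x) x ^+ (2 * p).
  by rewrite exprn_ge0 // ltW //; exact: hnorm_gt0.
rewrite !modCM modC_toC (ger0_norm h0) -mulrDl; apply: ler_wpM2r => //.
have -> : modC (s' (triv_at L x) x)^* = modC (s' (triv_at L x) x).
  by rewrite /modC norm_conjC.
have := modC_ge0 (s (triv_at L x) x); have := modC_ge0 (s' (triv_at L x) x).
set u := modC _; set v := modC _ => u0 v0.
have := sqr_ge0 (v - u); have := mulr_ge0 u0 v0; rewrite sqrrB; lra.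
Qed.

Lemma integral_combination p d (c : 'I_d -> C) (S : 'I_d -> triv L -> X -> C) :
  compact [set: X] -> (forall j, is_section p setT (S j)) ->
  (forall j k, inner_prod h p (S j) (S k) = (j == k)%:R) ->
  (\int[mu]_x (sqnorm h p (combination c S) x)%:E)%E =
    (\sum_j modC (c j) ^+ 2)%:E.
Proof.
move=> cX sS orth; have [D [mD D0 mH]] := conull_measurable_metric h cX.
pose re j k x := reC (herm_prod h p (S j) (S k) x).
pose im j k x := imC (herm_prod h p (S j) (S k) x).
have isq j : mu.-integrable D (fun x : borel X => (sqnorm h p (S j) x)%:E).
  apply/integrableP; split.
    apply/measurable_EFinP; exact: (mH p _ _ (sS j) (sS j)).1.
  have -> : (\int[mu]_(x in D) `|(sqnorm h p (S j) x)%:E| =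
      \int[mu]_(x in D) (sqnorm h p (S j) x)%:E)%E.
    by apply: eq_integral => x _; rewrite gee0_abs // lee_fin sqnorm_ge0.
  rewrite -(integral_conull mD D0).
  have int0 : (0 <= \int[mu]_x (sqnorm h p (S j) x)%:E)%E.
    by apply: integral_ge0 => x _; rewrite lee_fin sqnorm_ge0.
  (* The inner product is a real number even for an infinite integral, which [fine] sends to 0.
     Since its value is 1, the integral is finite. *)
  have := congr1 (@reC R) (orth j j); rewrite eqxx /= /Rintegral.
  rewrite -[fun x => (reC _)%:E]/(fun x => (sqnorm h p (S j) x)%:E).
  case: (\int[mu]_x _)%E int0 => [r _ _|_ /= /eqP|//].
    exact: ltry.
  by rewrite eq_sym oner_eq0.
have isum j k : mu.-integrable D
    (fun x : borel X => (sqnorm h p (S j) x)%:E + (sqnorm h p (S k) x)%:E)%E.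
  by apply: integrableD.
have ire j k : mu.-integrable D (fun x : borel X => (re j k x)%:E).
  apply: le_integrable (isum j k) => //.
    apply/measurable_EFinP; exact: (mH p _ _ (sS j) (sS k)).1.
  move=> x _; rewrite -EFinD lee_fin [leRHS]ger0_norm ?addr_ge0 ?sqnorm_ge0 //.
  exact: le_trans (Re_le_modC _) (herm_prod_le _ (sS j) (sS k)).
have iim j k : mu.-integrable D (fun x : borel X => (im j k x)%:E).
  apply: le_integrable (isum j k) => //.
    apply/measurable_EFinP; exact: (mH p _ _ (sS j) (sS k)).2.
  move=> x _; rewrite -EFinD lee_fin [leRHS]ger0_norm ?addr_ge0 ?sqnorm_ge0 //.
  exact: le_trans (Im_le_modC _) (herm_prod_le _ (sS j) (sS k)).
have vre j k : (\int[mu]_(x in D) (re j k x)%:E)%E = ((j == k)%:R)%:E.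
  have fin := integrable_fin_num mD (ire j k).
  have := congr1 (@reC R) (orth j k); rewrite /= /Rintegral.
  rewrite (integral_conull mD D0) => vE.
  rewrite -(fineK fin) vE; case: (j == k) => //.
have vim j k : (\int[mu]_(x in D) (im j k x)%:E)%E = 0%:E.
  have fin := integrable_fin_num mD (iim j k).
  have := congr1 (@imC R) (orth j k); rewrite /= /Rintegral.
  rewrite (integral_conull mD D0) => vE.
  rewrite -(fineK fin) vE; case: (j == k) => //.
rewrite (integral_conull mD D0).
pose al j k := reC (c j * (c k)^*); pose be j k := - imC (c j * (c k)^*).
have sqE x : (sqnorm h p (combination c S) x)%:E =
    (\sum_j \sum_k ((al j k)%:E * (re j k x)%:E + (be j k)%:E * (im j k x)%:E))%E.
  rewrite /sqnorm herm_prod_combination reC_sum -sumEFin; apply: eq_bigr => j _.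
  rewrite reC_sum -sumEFin; apply: eq_bigr => k _.
  by rewrite reCM -!EFinM -EFinD /al /be mulNr.
under eq_integral do rewrite sqE.
have it j k : mu.-integrable D (fun x : borel X =>
    (al j k)%:E * (re j k x)%:E + (be j k)%:E * (im j k x)%:E)%E.
  by apply: integrableD => //; apply: integrableZl.
rewrite integral_sum //; last by move=> j; apply: integrable_sum.
rewrite -sumEFin; apply: eq_bigr => j _.
rewrite integral_sum // (bigD1 j) //= big1 ?adde0 => [|k kj].
  rewrite integralD //; [|exact: integrableZl|exact: integrableZl].
  rewrite !integralZl // vre vim eqxx mule1 mule0 adde0 /al reC_mul_conj.
  by rewrite modC_sqr !expr2.
rewrite integralD //; [|exact: integrableZl|exact: integrableZl].
by rewrite !integralZl // vre vim eq_sym (negbTE kj) !mule0 adde0.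
Qed.

(* The section conj(S_1(x)) S_1 + ... + conj(S_d(x)) S_d is extremal at x. *)
Lemma bergman_le p (P : X -> R) (b : R) (x : X) : compact [set: X] -> 0 <= b ->
  (forall s J, in_H00 (L := L) Sigma t p s ->
     (\int[mu]_x (sqnorm h p s x)%:E)%E = J%:E -> sqnorm h p s x <= b * J) ->
  is_partial_bergman h Sigma t p P -> P x <= b.
Proof.
move=> cX b0 bound [d [S [[HS orth _] PE]]].
have sS j : is_section p setT (S j) by case: (HS j).
pose a := triv_at L x; have ax : tdom a x by exact: triv_atP.
pose c j : C := (S j a x)^*.
have mc j : modC (c j) = modC (S j a x) by rewrite /c /modC norm_conjC.
set T := \sum_j modC (S j a x) ^+ 2.
pose H := hnorm h a x ^+ (2 * p).
have H0 : 0 < H by rewrite exprn_gt0 //; exact: hnorm_gt0.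
have PxE : P x = T * H.
  by rewrite PE /T mulr_suml; apply: eq_bigr => j _; exact: sqnormE.
have T0 : 0 <= T by apply: sumr_ge0 => j _; exact: sqr_ge0.
have := bound _ _ (H00_combination c HS) (integral_combination c cX sS orth).
have [ss _] := H00_combination c HS.
rewrite (sqnormE h ss ax) -/H.
have -> : combination c S a x = toC T.
  rewrite /combination /T.
  rewrite (big_morph (@toC R) (@toCD R) (erefl : toC 0 = 0)).
  by apply: eq_bigr => j _; rewrite /c toCX -normCE normCK mulrC.
rewrite modC_toC (ger0_norm T0).
have -> : \sum_j modC (c j) ^+ 2 = T by apply: eq_bigr => j _; rewrite mc.
(* The extremal section has |s(x)|_h^2 = T^2 H and squared L^2 norm T, while P x = T H: the bound is
   divided by T unless T = 0. *)
rewrite PxE; move: T0; rewrite le_eqVlt => /orP[/eqP <-|T_gt0]; first by rewrite mul0r.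
by rewrite expr2 -mulrA [b * T]mulrC ler_pM2l.
Qed.

Lemma bergman_bounded p (P : X -> R) : compact [set: X] ->
  locally_bounded_weights h -> is_partial_bergman h Sigma t p P ->
  exists2 B : R, 0 <= B & forall x, 0 <= P x <= B.
Proof.
move=> cX hb [d [S [[HS _ _] PE]]].
have sS j : is_section p setT (S j) by case: (HS j).
have /choice[B BP] : forall j, exists B : R, forall x, sqnorm h p (S j) x <= B.
  by move=> j; have [B _ BP] := sqnorm_bounded hb cX (sS j); exists B.
have P0 x : 0 <= P x by rewrite PE; apply: sumr_ge0 => j _; exact: sqnorm_ge0.
have PB x : P x <= \sum_j B j by rewrite PE; apply: ler_sum.
by exists (\sum_j B j) => [|x]; rewrite ?P0 ?PB // (le_trans (P0 point)).
Qed.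

End BergmanKernel.

(** For l > 0 this is the l-th power of p <= l 2^(p / l), with the integer quotient in the
    exponent. *)
Lemma expn_le_exp2n l p : (p ^ l <= l ^ l * 2 ^ p)%N.
Proof.
case: l => [|l]; first by rewrite mul1n expn_gt0.
have pE : (p <= l.+1 * 2 ^ (p %/ l.+1))%N.
  apply: (@leq_trans (l.+1 * (p %/ l.+1).+1)); last by rewrite leq_mul2l ltn_expl.
  by rewrite mulnC ltnW // ltn_ceil.
apply: (@leq_trans ((l.+1 * 2 ^ (p %/ l.+1)) ^ l.+1)); first by rewrite leq_exp2r.
by rewrite expnMn -expnM leq_mul2l leq_pexp2l ?leq_divM ?orbT.
Qed.

Theorem theorem1p1 (R : realType) (n : nat) (X : ptopologicalType)
    (M : complex_atlas R n X) (X_hausdorff : hausdorff_space X)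
    (X_compact : compact [set: X])
    (omega : hermitian_form M) (mu : {measure set (borel X) -> \bar R})
    (mu_volume : is_volume omega mu)
    (Sigma : set X) (Sigma_smooth : smooth_hypersurface M Sigma)
    (t : R) (t_gt0 : 0 < t)
    (L : line_bundle M) (h : singular_metric L mu)
    (h_bounded : locally_bounded_weights h) :
  exists (U : set X) (a : R),
    [/\ open U, Sigma `<=` U, 0 < a < 1 &
        forall P : nat -> X -> R,
          (forall p, is_partial_bergman h Sigma t p (P p)) ->
          (forall x p, U x -> 2 * t^-1 < p%:R -> P p x <= a ^+ p) /\
          O_p_minus_infty U P].
Proof.
have [D D1 DP] := sup_le_integral mu_volume h_bounded X_compact.
(* Any value in (0, 1) could be prescribed at the price of a smaller neighborhood; 1/2 fits
   [expn_le_exp2n]. *)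
pose b : R := 1 / 2.
have b0 : 0 <= b by rewrite /b; lra.
(* All p and all sections are quantified inside, so that the neighborhood depends on neither. *)
pose good y := forall p (s : triv L -> X -> Cplx R) J, 2 * t^-1 < p%:R ->
  in_H00 (L := L) Sigma t p s -> (\int[mu]_x (sqnorm h p s x)%:E)%E = J%:E ->
  sqnorm h p s y <= b ^+ p * J.
have near_good x0 : Sigma x0 -> \forall y \near x0, good y.
  move=> Sx0.
  have [K K1 KP] := decay_near_hypersurface h_bounded Sigma_smooth Sx0.
  have DK1 : 1 <= D * K by rewrite mulr_ege1.
  (* The exponential loss (D K) ^+ p.+1 is beaten by taking e = q ^+ N with
     t N >= 1: since 2 k >= t p, e ^+ (2 k) <= q ^+ p. *)
  pose q := b / (D * K) ^+ 2.
  have DK0 : 0 < D * K by exact: lt_le_trans DK1.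
  have q0 : 0 < q by rewrite divr_gt0 ?exprn_gt0 // /b; lra.
  have q1 : q <= 1.
    rewrite /q ler_pdivrMr ?exprn_gt0 // mul1r (@le_trans _ _ 1) ?exprn_ege1 //.
    by rewrite /b; lra.
  pose N := (Num.truncn t^-1).+1.
  have tN : 1 <= t * N%:R.
    by rewrite mulrC -ler_pdivrMr // mul1r ltW // truncnS_gt.
  apply: filterS (KP (q ^+ N) (exprn_gt0 N q0)) => y Hy p s J tp [ss van] sJ.
  have [m [m0 sm mJ]] := DP p s ss.
  have := Hy p _ s m ss van m0 sm; set k := Num.truncn _ => le1.
  have {mJ} mJ : m ^+ 2 <= D ^+ p.+1 * J by move: mJ; rewrite sJ -EFinM lee_fin.
  have J0 : 0 <= J.
    by rewrite -lee_fin -sJ; apply: integral_ge0 => x _; exact: sqnorm_ge0.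
  have p0 : (0 < p)%N.
    by rewrite -(ltr0n R); apply: le_lt_trans tp; rewrite mulr_ge0 // invr_ge0 ltW.
  (* From k > t p - 1 and t p > 2: this is what the condition p > 2 / t is for. *)
  have kp : t * p%:R <= 2 * k%:R.
    have := truncnS_gt (t * p%:R); rewrite -/k -natr1.
    have : 2 < t * p%:R by rewrite mulrC -ltr_pdivrMr.
    lra.
  have pNk : (p <= N * k * 2)%N.
    rewrite -(ler_nat R) !natrM.
    have := ler_wpM2l (ler0n R p) tN.
    have := ler_wpM2r (ler0n R N) kp.
    lra.
  have qk : ((q ^+ N) ^+ k) ^+ 2 <= q ^+ p.
    by rewrite -!exprM mulnA ler_wiXn2l // ltW.
  have K0 : 0 <= K ^+ p.+1 by rewrite exprn_ge0 // (le_trans _ K1).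
  apply: (le_trans le1).
  apply: (@le_trans _ _ (K ^+ p.+1 * q ^+ p * (D ^+ p.+1 * J))).
    apply: ler_pM; [|exact: sqr_ge0|by rewrite ler_wpM2l|exact: mJ].
    by apply: mulr_ge0 => //; exact: sqr_ge0.
  have -> : K ^+ p.+1 * q ^+ p * (D ^+ p.+1 * J) = (D * K) ^+ p.+1 * q ^+ p * J.
    by rewrite [(D * K) ^+ p.+1]exprMn; ring.
  apply: ler_wpM2r => //.
  (* What remains is (D K)^(p + 1) <= (D K)^(2 p), true since p >= 1; hence the square in [q]. *)
  rewrite /q expr_div_n mulrCA -[leRHS]mulr1; apply: ler_wpM2l.
    by rewrite exprn_ge0.
  rewrite ler_pdivrMr ?exprn_gt0 // mul1r -exprM ler_weXn2l //.
  by rewrite mulSn -addn1 addnC leq_add // mul1n.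
exists (interior [set y | good y]), b; split.
- exact: open_interior.
- by move=> x0 /near_good.
- by rewrite /b; lra.
move=> P HP.
have P_le x p : interior [set y | good y] x -> 2 * t^-1 < p%:R -> P p x <= b ^+ p.
  move=> /interior_subset gx tp.
  apply: (bergman_le X_compact _ _ (HP p)); first by rewrite exprn_ge0.
  by move=> s J Hs sJ; exact: gx.
split; first by move=> x p; exact: P_le.
move=> S _ SU l.
have /choice[B BP] : forall p, exists B : R, 0 <= B /\ forall x, 0 <= P p x <= B.
  by move=> p; have [B ? ?] := bergman_bounded X_compact h_bounded (HP p); exists B.
pose N := (Num.truncn (2 * t^-1)).+1.
pose T : R := \sum_(p < N) B p * p%:R ^+ l.
have term0 p : 0 <= B p * p%:R ^+ l.
  by rewrite mulr_ge0 ?exprn_ge0 //; case: (BP p).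
have T0 : 0 <= T by apply: sumr_ge0.
have ll0 : 0 <= (l%:R : R) ^+ l by rewrite exprn_ge0.
(* [T] handles the p below N, [l%:R ^+ l] the decay for the other p, and 1 makes the constant
   positive. *)
exists (T + l%:R ^+ l + 1); first by rewrite ltr_wpDl ?addr_ge0.
move=> p x p0 Sx; have [Bp0 /(_ x) /andP[P0 PB]] := BP p.
have pl0 : 0 < (p%:R : R) ^+ l by rewrite exprn_gt0 // ltr0n.
rewrite ger0_norm // ler_pdivlMr //.
have [pN|Np] := ltnP p N.
  have : P p x * p%:R ^+ l <= B p * p%:R ^+ l by rewrite ler_pM2r.
  have : B p * p%:R ^+ l <= T.
    rewrite /T (bigD1 (Ordinal pN)) //= lerDl.
    by apply: sumr_ge0 => j _.
  lra.
have Pp : P p x <= b ^+ p.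
  apply: P_le; first exact: SU.
  by apply: (lt_le_trans (truncnS_gt _)); rewrite ler_nat.
have : P p x * p%:R ^+ l <= b ^+ p * p%:R ^+ l by rewrite ler_pM2r.
have : b ^+ p * p%:R ^+ l <= l%:R ^+ l.
  rewrite /b expr_div_n expr1n mul1r mulrC ler_pdivrMr ?exprn_gt0 //.
  by rewrite -!natrX -natrM ler_nat expn_le_exp2n.
lra.
Qed.
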